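(* Let $D$ be a non-commutative division ring with center $F$ and let $M$ be an irreducible locally solvable maximal subgroup of $D^*$. Then the derived subgroup $M'$ is algebraic over $F$ if and only if $M$ is metabelian and there exists an element $x\in M\setminus F$ that is algebraic over $F$.
   Context: $D^*$ is the multiplicative group of $D$; maximal subgroup = proper subgroup maximal among proper subgroups. A subgroup $G\le D^*$ is irreducible if the division subring $F(G)$ generated by $F\cup G$ equals $D$. Locally solvable: every finitely generated subgroup solvable. Metabelian: $M'$ is abelian. *)

(* Defs.v *)
From mathcomp Require Import all_boot all_algebra.
Set Implicit Arguments. Unset Strict Implicit. Unset Printing Implicit Defensive.
Import GRing.Theory.
Local Open Scope ring_scope.

Definition is_division_ring (D : unitRingType) : Prop :=
  forall x : D, x != 0 -> x \is a GRing.unit.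

Section DivRing.
Variable D : unitRingType.

Definition center (x : D) : Prop := forall y : D, x * y = y * x.

Definition is_subgroup (G : D -> Prop) : Prop :=
  [/\ G 1, (forall x, G x -> x != 0),
      (forall x y, G x -> G y -> G (x * y)) & (forall x, G x -> G (x^-1))].

Definition gen_subgroup (S : D -> Prop) : D -> Prop :=
  fun x => forall H, is_subgroup H -> (forall y, S y -> H y) -> H x.

Definition commutator (x y : D) : D := x^-1 * y^-1 * x * y.

Definition derived (G : D -> Prop) : D -> Prop :=
  gen_subgroup (fun z => exists x y, [/\ G x, G y & z = commutator x y]).

Definition is_solvable (G : D -> Prop) : Prop :=
  exists n, forall x, iter n derived G x -> x = 1.

Definition locally_solvable (G : D -> Prop) : Prop :=
  forall s : seq D, (forall x, x \in s -> G x) ->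
    is_solvable (gen_subgroup (fun x => x \in s)).

Definition abelian_set (G : D -> Prop) : Prop :=
  forall x y, G x -> G y -> x * y = y * x.

Definition metabelian (G : D -> Prop) : Prop := abelian_set (derived G).

Definition maximal_subgroup (M : D -> Prop) : Prop :=
  [/\ is_subgroup M, (exists x, x != 0 /\ ~ M x) &
      forall H, is_subgroup H -> (forall x, M x -> H x) ->
        (exists x, x != 0 /\ ~ H x) -> forall x, H x -> M x].

Definition is_division_subring (S : D -> Prop) : Prop :=
  [/\ S 0, S 1, (forall x y, S x -> S y -> S (x - y)),
      (forall x y, S x -> S y -> S (x * y)) &
      (forall x, S x -> x != 0 -> S (x^-1))].

Definition gen_divsubring_over_center (G : D -> Prop) : D -> Prop :=
  fun x => forall S, is_division_subring S ->
    (forall y, center y -> S y) -> (forall y, G y -> S y) -> S x.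

Definition irreducible_subgroup (G : D -> Prop) : Prop :=
  forall x, gen_divsubring_over_center G x.

Definition algebraic_over_center (x : D) : Prop :=
  exists p : {poly D}, [/\ p != 0, (forall i, center p`_i) & p.[x] = 0].

Definition algebraic_set (G : D -> Prop) : Prop :=
  forall x, G x -> algebraic_over_center x.

End DivRing.

(* Main.v *)
(* Call a stable if every positive power of a has the same centraliser as a.
   Each algebraic element has a stable power, and in a locally solvable group
   of algebraic elements the stable elements commute with one another; they
   generate an abelian normal subgroup. If all abelian normal subgroups are
   central, the group is thus torsion modulo its centre, its derived length is
   at most 6, and its last noncentral derived term has class 2. Comparing p-th
   powers there rules out everything except a normal quaternion group of order
   8.

   Since M is maximal, a division subring E normalised by M has its units in M
   (and is then commutative, by Hua's theorem), is central, or is all of D.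
   When M' is algebraic and M has no noncentral abelian normal subgroup inside
   M', the dichotomy gives a normal quaternion group, and integer quaternions
   produce a proper subgroup larger than M. Otherwise the centraliser L of a
   conjugacy class is a maximal subfield whose units have finite index in M,
   and each term N of the derived series not contained in L spans D over L,
   whence M is the product of N with the units of L by Dedekind's independence
   argument; hence M' lies in L.

   Conversely, for M metabelian take L the centraliser of M'. Some y in M
   outside L acts on L with finite order and central fixed field, so the
   elements of L are algebraic. *)
From mathcomp Require Import all_boot all_order all_algebra.
From mathcomp Require Import fingroup perm cyclic alt ring zify.
From Stdlib Require Import Classical.
Require Import Defs.
Set Implicit Arguments. Unset Strict Implicit. Unset Printing Implicit Defensive.
Import Order.TTheory GRing.Theory Num.Theory.
Local Open Scope ring_scope.


(** * Conjugation, subgroups and division subrings *)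

Section DivisionRing.

Context (D : unitRingType) (hD : is_division_ring D).
Implicit Types (a b c g h u v w x y z : D) (A B E G H K M : D -> Prop).

(** Local solvability bounds no derived length, so [M] need not have a last noncentral derived term
    to start from. Two devices get around this. Whether two stable elements commute concerns only
    the subgroup that they generate, which is solvable, and stability turns conjugation of finite
    order into trivial conjugation. For a group that is torsion modulo its centre, the bound 6 = 2 +
    3 + 1 does not depend on the generators: two derivations make the group centralise its abelian
    normal subgroups, three more make it fix elements of prime order modulo the centre in a class 2
    term, and the last one turns a central term into a trivial one. The 2-part costs most: a
    quaternion group can survive there, on whose three lines the group acts through S_3. *)

Lemma mulrI_div x y z : x != 0 -> x * y = x * z -> y = z.
Proof. by move=> x0; apply: mulrI; apply: hD. Qed.

Lemma mulIr_div x y z : x != 0 -> y * x = z * x -> y = z.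
Proof. by move=> x0; apply: mulIr; apply: hD. Qed.

Lemma mulf_eq0_div x y : x * y = 0 -> x = 0 \/ y = 0.
Proof.
have [-> _|x0 e] := eqVneq x 0; first by left.
by right; apply: (mulrI_div x0); rewrite mulr0.
Qed.

Lemma mulf_neq0_div x y : x != 0 -> y != 0 -> x * y != 0.
Proof. by move=> x0 y0; apply/eqP => /mulf_eq0_div [] /eqP; apply/negP. Qed.

Lemma invr_neq0_div x : x != 0 -> x^-1 != 0.
Proof. by rewrite invr_eq0. Qed.

Lemma expf_neq0_div x n : x != 0 -> x ^+ n != 0.
Proof.
by move=> x0; elim: n => [|n ih]; rewrite ?oner_neq0 // exprS mulf_neq0_div.
Qed.

Lemma sqr_eq1_div x : x * x = 1 -> x = 1 \/ x = -1.
Proof.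
move=> e; have: (x - 1) * (x + 1) = 0.
  by rewrite mulrDr mulr1 mulrBl mul1r e addrA subrK subrr.
case/mulf_eq0_div=> /eqP; [rewrite subr_eq0 | rewrite addr_eq0] => /eqP; tauto.
Qed.

Definition cj g x : D := g^-1 * x * g.

Lemma cjD g : {morph cj g : x y / x + y}.
Proof. by move=> x y; rewrite /cj mulrDr mulrDl. Qed.
Lemma cjB g : {morph cj g : x y / x - y}.
Proof. by move=> x y; rewrite /cj mulrBr mulrBl. Qed.
Lemma cjN g : {morph cj g : x / - x}.
Proof. by move=> x; rewrite /cj mulrN mulNr. Qed.
Lemma cj0 g : cj g 0 = 0.
Proof. by rewrite /cj mulr0 mul0r. Qed.
Lemma cj1g x : cj 1 x = x.
Proof. by rewrite /cj invr1 mul1r mulr1. Qed.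

Section Conj.
Context (g : D) (g0 : g != 0).
Let Ug : g \is a GRing.unit := hD g0.

Lemma cjE x : g * cj g x = x * g.
Proof. by rewrite /cj -mulrA mulVKr. Qed.
Lemma cj_intro x y : g * y = x * g -> cj g x = y.
Proof. by move=> e; apply: (mulrI Ug); rewrite cjE. Qed.
Lemma cj1 : cj g 1 = 1.
Proof. by apply: cj_intro; rewrite mulr1 mul1r. Qed.
Lemma cjM : {morph cj g : x y / x * y}.
Proof. by move=> x y; rewrite /cj !mulrA mulrK. Qed.
Lemma cjX n : {morph cj g : x / x ^+ n}.
Proof. by move=> x; elim: n => [|n ih]; rewrite ?cj1 // !exprS cjM ih. Qed.
Lemma cj_neq0 x : x != 0 -> cj g x != 0.
Proof.
by move=> x0; rewrite /cj !mulf_neq0_div ?invr_neq0_div.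
Qed.
Lemma cjV x : cj g x^-1 = (cj g x)^-1.
Proof.
have [->|x0] := eqVneq x 0; first by rewrite cj0 invr0 cj0.
by rewrite /cj !invrM ?invrK ?mulrA ?unitrMr ?unitrV ?hD.
Qed.
Lemma cjK : cancel (cj g) (cj g^-1).
Proof. by move=> x; rewrite /cj invrK !mulrA divrr // mul1r mulrK. Qed.
Lemma cjVK : cancel (cj g^-1) (cj g).
Proof. by move=> x; rewrite /cj invrK !mulrA mulVr // mul1r mulrVK. Qed.
Lemma cj_inj : injective (cj g). Proof. exact: can_inj cjK. Qed.
Lemma cj_comm x : GRing.comm x g -> cj g x = x.
Proof. by move=> e; apply: cj_intro; rewrite e. Qed.
Lemma cj_fix x : cj g x = x -> GRing.comm x g.
Proof. by move=> e; rewrite /GRing.comm -cjE e. Qed.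
Lemma cjMg h x : h != 0 -> cj (g * h) x = cj h (cj g x).
Proof. by move=> h0; rewrite /cj invrM ?hD // !mulrA. Qed.
Lemma cj_expg n x : cj (g ^+ n) x = iter n (cj g) x.
Proof.
elim: n x => [|n ih] x; first by rewrite cj1g.
rewrite exprS iterSr -ih /cj invrM ?mulrA // unitrX //.
Qed.
Lemma cj_sum (I : Type) (r : seq I) (P : pred I) (f : I -> D) :
  cj g (\sum_(i <- r | P i) f i) = \sum_(i <- r | P i) cj g (f i).
Proof. by elim/big_rec2: _ => [|i y z _ <-]; rewrite ?cj0 ?cjD. Qed.
Lemma cj_commute x y : GRing.comm x y -> GRing.comm (cj g x) (cj g y).
Proof. by rewrite /GRing.comm -!cjM => ->. Qed.
End Conj.

Lemma cj_commuting g x y :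
  g != 0 -> GRing.comm (cj g x) y -> GRing.comm x (cj g^-1 y).
Proof.
move=> g0 e; rewrite -{1}(cjK g0 x).
by apply: cj_commute => //; apply: invr_neq0_div.
Qed.

Lemma commutatorE x y : commutator x y = x^-1 * cj y x.
Proof. by rewrite /commutator /cj !mulrA. Qed.

Lemma cj_commutator x y : x != 0 -> cj y x = x * commutator x y.
Proof. by move=> x0; rewrite commutatorE mulVKr ?hD. Qed.

Lemma cj_commutatorM g x y :
  g != 0 -> cj g (commutator x y) = commutator (cj g x) (cj g y).
Proof. by move=> g0; rewrite /commutator !cjM ?cjV. Qed.

Definition inv_under G A := forall g x, G g -> A x -> A (cj g x).
Definition cent A x := forall y, A y -> GRing.comm x y.

Lemma cent_divsubring A : is_division_subring (cent A).
Proof.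
split=> [y _|y _|x y hx hy z hz|x y hx hy z hz|x hx _ y hy].
- exact/commr_sym/commr0.
- exact/commr_sym/commr1.
- by apply/commr_sym/commrB; apply/commr_sym; auto.
- by apply/commr_sym/commrM; apply/commr_sym; auto.
- by apply/commr_sym/commrV/commr_sym; auto.
Qed.

Lemma center_cent x : center x <-> cent (fun=> True) x.
Proof. by split=> h y; [move=> _|]; apply: h. Qed.

Lemma center_divsubring : is_division_subring (@center D).
Proof.
have [h0 h1 hB hM hV] := cent_divsubring (fun=> True).
split; try by apply/center_cent.
- by move=> x y /center_cent hx /center_cent hy; apply/center_cent/hB.
- by move=> x y /center_cent hx /center_cent hy; apply/center_cent/hM.
- by move=> x /center_cent hx x0; apply/center_cent/hV.
Qed.

Section Subring.
Context (K : D -> Prop) (hK : is_division_subring K).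
Lemma dsr0 : K 0. Proof. by case: hK. Qed.
Lemma dsr1 : K 1. Proof. by case: hK. Qed.
Lemma dsrB x y : K x -> K y -> K (x - y). Proof. by case: hK => _ _ h _ _; apply: h. Qed.
Lemma dsrM x y : K x -> K y -> K (x * y). Proof. by case: hK => _ _ _ h _; apply: h. Qed.
Lemma dsrN x : K x -> K (- x).
Proof. by move=> h; rewrite -sub0r; apply: dsrB => //; apply: dsr0. Qed.
Lemma dsrD x y : K x -> K y -> K (x + y).
Proof. by move=> hx hy; rewrite -[y]opprK; apply: dsrB => //; apply: dsrN. Qed.
Lemma dsrV x : K x -> K x^-1.
Proof.
have [->|x0 h] := eqVneq x 0; first by rewrite invr0.
by case: hK => _ _ _ _; apply.
Qed.
Lemma dsr_sum (I : Type) (r : seq I) (P : pred I) (f : I -> D) :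
  (forall i, P i -> K (f i)) -> K (\sum_(i <- r | P i) f i).
Proof. by move=> h; elim/big_rec: _ => [|i x Pi]; [apply: dsr0|apply/dsrD/h]. Qed.

Lemma dsr_nat n : K n%:R.
Proof. by elim: n => [|n ih]; [apply: dsr0|rewrite mulrSr; apply/dsrD/dsr1]. Qed.
Lemma dsr_subgroup : is_subgroup (fun x => K x /\ x != 0).
Proof.
split.
- by split; [apply: dsr1|apply: oner_neq0].
- by move=> x [].
- by move=> x y [hx x0] [hy y0]; split; [apply: dsrM|apply: mulf_neq0_div].
- by move=> x [hx x0]; split; [apply: dsrV|apply: invr_neq0_div].
Qed.
End Subring.

Section Subgroup.
Context (G : D -> Prop) (hG : is_subgroup G).
Lemma sg1 : G 1. Proof. by case: hG. Qed.
Lemma sg_neq0 x : G x -> x != 0. Proof. by case: hG => _ h _ _; apply: h. Qed.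
Lemma sgM x y : G x -> G y -> G (x * y). Proof. by case: hG => _ _ h _; apply: h. Qed.
Lemma sgV x : G x -> G x^-1. Proof. by case: hG => _ _ _; apply. Qed.
Lemma sgX x n : G x -> G (x ^+ n).
Proof.
by move=> h; elim: n => [|n ih]; [apply: sg1|rewrite exprS; apply: sgM].
Qed.
Lemma sg_cj x y : G x -> G y -> G (cj x y).
Proof. by move=> hx hy; do 2?apply: sgM => //; apply: sgV. Qed.
Lemma sg_comm x y : G x -> G y -> G (commutator x y).
Proof. by move=> hx hy; rewrite commutatorE; apply: sgM; [apply: sgV|apply: sg_cj]. Qed.
Lemma sg_cent A : is_subgroup (fun x => G x /\ cent A x).
Proof.
have hC := cent_divsubring A.
split.
- by split; [apply: sg1|apply: dsr1 hC].
- by move=> x [] /sg_neq0.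
- by move=> x y [hx cx] [hy cy]; split; [apply: sgM|apply: dsrM hC _ _ _ _].
- by move=> x [hx cx]; split; [apply: sgV|apply: dsrV hC _ _].
Qed.
End Subgroup.

Lemma nz_subgroup : is_subgroup (fun x : D => x != 0).
Proof.
by split=> // [|x y|x]; [apply: oner_neq0|apply: mulf_neq0_div|apply: invr_neq0_div].
Qed.

Lemma sub_gen S x : S x -> gen_subgroup S x. Proof. by move=> h H _; apply. Qed.

Lemma gen_subgroupP (S : D -> Prop) : (forall x, S x -> x != 0) -> is_subgroup (gen_subgroup S).
Proof.
move=> S0; split.
- by move=> H hH _; apply: sg1.
- by move=> x /(_ _ nz_subgroup S0).
- by move=> x y hx hy H hH hS; apply: sgM; [|apply: hx|apply: hy].
- by move=> x hx H hH hS; apply: sgV; [|apply: hx].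
Qed.

Lemma gen_mono (S T : D -> Prop) x :
  (forall y, S y -> T y) -> gen_subgroup S x -> gen_subgroup T x.
Proof. by move=> ST h H hH hT; apply: h => // y /ST /hT. Qed.

Lemma gen_inv (S : D -> Prop) G : is_subgroup G -> (forall x, S x -> x != 0) ->
  inv_under G S -> inv_under G (gen_subgroup S).
Proof.
move=> hG S0 hS g x Gg hx; have g0 := sg_neq0 hG Gg.
have hT := gen_subgroupP S0.
apply: (hx (fun y => gen_subgroup S (cj g y))); last first.
  by move=> y hy; apply: sub_gen; apply: hS.
split.
- by rewrite cj1 //; apply: (sg1 hT).
- by move=> y /(sg_neq0 hT); apply: contra_neq => ->; rewrite cj0.
- by move=> y z hy hz; rewrite cjM //; apply: (sgM hT).
- by move=> y hy; rewrite cjV //; apply: (sgV hT).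
Qed.

Lemma gen_cent (S A : D -> Prop) x : (forall y, S y -> cent A y) -> (forall y, S y -> y != 0) ->
  gen_subgroup S x -> cent A x.
Proof.
by move=> h h0 /(_ _ (sg_cent nz_subgroup A)) [] // y hy; split; auto.
Qed.

Lemma gen_abelian (S : D -> Prop) : (forall y, S y -> y != 0) -> abelian_set S ->
  abelian_set (gen_subgroup S).
Proof.
move=> S0 hS x y hx; apply: (gen_cent (A := gen_subgroup S) _ _ hx) => // z Sz t ht.
apply/commr_sym; apply: (gen_cent (A := eq z) _ _ ht) => // s Ss r <-.
exact: hS.
Qed.

Section Derived.
Context (G : D -> Prop) (hG : is_subgroup G).
Lemma comm_neq0 z : (exists x y, [/\ G x, G y & z = commutator x y]) -> z != 0.
Proof. by case=> x [y [hx hy ->]]; apply: (sg_neq0 hG); apply: sg_comm. Qed.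
Lemma derived_subgroup : is_subgroup (derived G).
Proof. exact: gen_subgroupP comm_neq0. Qed.
Lemma derived_sub x : derived G x -> G x.
Proof. by apply=> // y [a [b [ha hb ->]]]; apply: sg_comm. Qed.
Lemma derived_comm x y : G x -> G y -> derived G (commutator x y).
Proof. by move=> hx hy; apply: sub_gen; exists x, y. Qed.
Lemma derived_ind (P : D -> Prop) : is_subgroup P ->
  (forall x y, G x -> G y -> P (commutator x y)) -> forall x, derived G x -> P x.
Proof. by move=> hP h x; apply=> // y [a [b [ha hb ->]]]; apply: h. Qed.
Lemma derived_inv M : is_subgroup M -> inv_under M G -> inv_under M (derived G).
Proof.
move=> hM hMG; apply: gen_inv => //; first exact: comm_neq0.
move=> m z Mm [x [y [hx hy ->]]]; exists (cj m x), (cj m y).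
by rewrite cj_commutatorM ?(sg_neq0 hM) //; split=> //; apply: hMG.
Qed.
End Derived.

Lemma derived_mono G H x : (forall y, G y -> H y) -> derived G x -> derived H x.
Proof. by move=> h; apply: gen_mono => z [a [b [ha hb ->]]]; exists a, b; split; auto. Qed.

Section IterDerived.
Context (G : D -> Prop) (hG : is_subgroup G).
Lemma der_subgroup n : is_subgroup (iter n (@derived D) G).
Proof. by elim: n => //= n ih; apply: derived_subgroup. Qed.
Lemma der_sub m n x : (m <= n)%N -> iter n (@derived D) G x -> iter m (@derived D) G x.
Proof.
move/subnK <-; elim: (n - m)%N => // k ih h; apply: ih.
by apply: derived_sub h; apply: der_subgroup.
Qed.
Lemma der_inv n M : is_subgroup M -> inv_under M G -> inv_under M (iter n (@derived D) G).
Proof.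
by move=> hM hMG; elim: n => //= n ih; apply: derived_inv => //; apply: der_subgroup.
Qed.
End IterDerived.

Lemma der_mono n G H x : (forall y, G y -> H y) ->
  iter n (@derived D) G x -> iter n (@derived D) H x.
Proof. by move=> h; elim: n x => [|n ih] x /=; [apply: h|apply: derived_mono]. Qed.


(** The form in which abelian actions are used throughout: if a group moves [a] by commuting
    conjugations, its derived subgroup fixes [a]. *)
Lemma commutator_fix x y a : x != 0 -> y != 0 ->
  cj x^-1 (cj y^-1 a) = cj y^-1 (cj x^-1 a) -> GRing.comm a (commutator x y).
Proof.
move=> x0 y0 e; have [x1 y1] := (invr_neq0_div x0, invr_neq0_div y0).
apply: cj_fix; first by rewrite !mulf_neq0_div.
rewrite /commutator -mulrA !cjMg ?mulf_neq0_div //.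
by rewrite -e !cjVK.
Qed.

End DivisionRing.


(** * Algebraic elements and stable powers *)

Section Algebraic.

Context (D : unitRingType) (hD : is_division_ring D).
Implicit Types (a b c g h u v w x y z : D) (A B E G H K M : D -> Prop).

Lemma root_cj (p : {poly D}) g x : g != 0 -> (forall i, center p`_i) ->
  p.[x] = 0 -> p.[cj g x] = 0.
Proof.
move=> g0 hp; rewrite !horner_coef => e.
transitivity (cj g (\sum_(i < size p) p`_i * x ^+ i)); last by rewrite e cj0.
rewrite cj_sum; apply: eq_bigr => i _.
by rewrite cjM // cjX // [cj g p`_i]cj_comm //; apply: hp.
Qed.

(** Over a division ring a polynomial can have infinitely many roots, but no more than its degree
    that commute pairwise. Conjugates of [x] are roots since the coefficients are central, so
    [size p] commuting ones cannot all differ. *)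
Lemma conj_repeat x : algebraic_over_center x -> exists n : nat, forall y : nat -> D,
  (forall i, exists2 g, g != 0 & y i = cj g x) ->
  (forall i j, GRing.comm (y i) (y j)) ->
  exists i j : nat, [/\ (i < j)%N, (j < n)%N & y i = y j].
Proof.
case=> p [p0 hp px]; exists (size p) => y hy cy; apply: NNPP => H.
suff : (size (mkseq y (size p)) < size p)%N by rewrite size_mkseq ltnn.
apply: max_ring_poly_roots => //.
  apply/allP => _ /mapP [i _ ->]; have [g g0 ->] := hy i.
  by apply/eqP/root_cj.
have: pairwise (@diff_roots D) (mkseq y (size p)).
  apply/(pairwiseP 0) => i j; rewrite !inE size_mkseq => hi hj ij.
  rewrite !nth_mkseq // /diff_roots cy eqxx /=; apply: hD.
  by rewrite subr_eq0; apply/eqP => e; apply: H; exists i, j.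
by elim: (mkseq _ _) => //= z s ih /andP [-> /ih].
Qed.

Definition lspan K (I : finType) (s : I -> D) x :=
  exists2 c : I -> D, (forall i, K (c i)) & x = \sum_i c i * s i.

Definition dependent K n (v : 'I_n -> D) :=
  exists c : 'I_n -> D, [/\ forall i, K (c i), exists i, c i != 0 & \sum_i c i * v i = 0].

Section Dependence.
Context (K : D -> Prop) (hK : is_division_subring K).

Lemma lspan_gen (I : finType) (s : I -> D) i : lspan K s (s i).
Proof.
exists (fun j => (j == i)%:R); first by move=> j; apply: dsr_nat.
by rewrite (bigD1 i) //= eqxx mul1r big1 ?addr0 // => j /negbTE ->; rewrite mul0r.
Qed.

Lemma lspan_sum (I J : finType) (s : I -> D) (f : J -> D) :
  (forall j, lspan K s (f j)) -> lspan K s (\sum_j f j).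
Proof.
move=> /fin_all_exists2 [c hc hf]; exists (fun i => \sum_j c j i).
  by move=> i; apply: dsr_sum.
rewrite (eq_bigr _ (fun j _ => hf j)) exchange_big /=.
by apply: eq_bigr => i _; rewrite mulr_suml.
Qed.

Lemma lspanZ (I : finType) (s : I -> D) k x : K k -> lspan K s x -> lspan K s (k * x).
Proof.
move=> hk [c hc ->]; exists (fun i => k * c i); first by move=> i; apply: dsrM.
by rewrite mulr_sumr; apply: eq_bigr => i _; rewrite mulrA.
Qed.

Lemma dependentP n (s : 'I_n -> D) (v : 'I_n.+1 -> D) :
  (forall i, lspan K s (v i)) -> dependent K v.
Proof.
elim: n s v => [|n ih] s v hv.
  exists (fun=> 1); split=> [_||]; [exact: dsr1|by exists ord0; apply: oner_neq0|].
  rewrite big_ord1 mul1r; have [c _ ->] := hv ord0.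
  by rewrite big_ord0.
have [C hC hvC] := fin_all_exists2 hv.
(* Pivot row for eliminating [s ord0]. If the whole column vanishes any row will do, as every [al i]
   is then 0. *)
have [j hj] : exists j, C j ord0 = 0 -> forall i, C i ord0 = 0.
  have [[j hj]|h] := classic (exists j, C j ord0 <> 0); first by exists j.
  by exists ord0 => _ i; apply: NNPP => h'; apply: h; exists i.
pose al i := C (lift j i) ord0 * (C j ord0)^-1.
have hal i : K (al i) by apply: dsrM => //; apply: dsrV.
pose w i := v (lift j i) - al i * v j.
have [|d [hd [i0 di0] hdw]] := ih (fun k => s (lift ord0 k)) w.
  move=> i; exists (fun k => C (lift j i) (lift ord0 k) - al i * C j (lift ord0 k)).
    by move=> k; apply: dsrB => //; apply: dsrM.
  rewrite /w !hvC mulr_sumr !big_ord_recl opprD addrACA.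
  suff -> : C (lift j i) ord0 * s ord0 - al i * (C j ord0 * s ord0) = 0.
    rewrite add0r -sumrB; apply: eq_bigr => k _.
    by rewrite mulrBl mulrA.
  rewrite /al mulrA -mulrBl; have [e|e] := eqVneq (C j ord0) 0.
    by rewrite (hj e) e !mul0r subrr mul0r.
  by rewrite mulrVK ?hD // subrr mul0r.
exists (fun k => if unlift j k is Some i then d i else - \sum_i d i * al i).
split.
- move=> k; case: unliftP => [i|] _ //; apply: (dsrN hK).
  by apply: (dsr_sum hK) => i _; apply: dsrM.
- by exists (lift j i0); rewrite liftK.
rewrite (bigD1_ord j) //= unlift_none mulNr mulr_suml addrC -sumrB -[RHS]hdw.
by apply: eq_bigr => i _; rewrite liftK /w mulrBr !mulrA.
Qed.

Lemma dependent_fin (I : finType) (s : I -> D) (v : 'I_#|I|.+1 -> D) :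
  (forall i, lspan K s (v i)) -> dependent K v.
Proof.
move=> hv; apply: (@dependentP _ (fun i => s (enum_val i))) => i.
have [c hc ->] := hv i; exists (fun i => c (enum_val i)) => // .
by rewrite -(big_enum_val (fun j => c j * s j)).
Qed.

End Dependence.

Notation Z := (@center D).
Let hZ : is_division_subring Z := center_divsubring D.

Lemma algebraicP x :
  algebraic_over_center x <-> exists n, dependent Z (fun i : 'I_n => x ^+ i).
Proof.
split=> [[p [p0 hp px]]|[n [c [hc [i ci] e]]]].
  exists (size p), (fun i => p`_i); split=> //; last by rewrite -horner_coef.
  have h : ((size p).-1 < size p)%N by rewrite {2}(polySpred p0).
  by exists (Ordinal h); rewrite /= lead_coef_eq0.
exists (\poly_(i < n) (if insub i is Some j then c j else 0)); split.
- apply/eqP => /polyP /(_ i); rewrite coef_poly ltn_ord coef0 valK => e0.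
  by rewrite e0 eqxx in ci.
- move=> k; rewrite coef_poly; case: ifP => _; last exact: dsr0.
  by case: insubP => [j _ _|_]; [apply: hc|apply: dsr0].
- by rewrite horner_poly -[RHS]e; apply: eq_bigr => j _; rewrite valK.
Qed.

Lemma exp_span x n (c : 'I_n.+1 -> D) : (forall i, Z (c i)) -> c ord_max != 0 ->
  \sum_i c i * x ^+ i = 0 -> forall k, lspan Z (fun i : 'I_n => x ^+ i) (x ^+ k).
Proof.
move=> hc c0 e.
have hd : lspan Z (fun i : 'I_n => x ^+ i) (x ^+ n).
  exists (fun i : 'I_n => - ((c ord_max)^-1 * c (widen_ord (leqnSn n) i))).
    by move=> i; apply: (dsrN hZ); apply: (dsrM hZ); [apply: (dsrV hZ)|]; apply: hc.
  apply: (mulrI_div hD c0); rewrite mulr_sumr.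
  move: e; rewrite big_ord_recr /= => /eqP; rewrite addrC addr_eq0 => /eqP ->.
  by rewrite -sumrN; apply: eq_bigr => i _; rewrite mulNr mulrN mulrA mulVKr ?hD.
elim=> [|k [d hdd ek]].
  have [n0|h] := posnP n; last exact: (lspan_gen hZ _ (Ordinal h)).
  by rewrite n0 in hd *.
rewrite exprSr ek mulr_suml; apply: (lspan_sum hZ) => i.
rewrite -mulrA -exprSr; apply: (lspanZ hZ); first exact: hdd.
have := ltn_ord i; rewrite leq_eqVlt => /orP [/eqP -> //|h].
exact: (lspan_gen hZ _ (Ordinal h)).
Qed.

Lemma alg_exp_span x : algebraic_over_center x ->
  exists n, forall k, lspan Z (fun i : 'I_n => x ^+ i) (x ^+ k).
Proof.
case=> p [p0 hp px]; exists (size p).-1.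
apply: (@exp_span _ _ (fun i => p`_i)) => //; first by rewrite lead_coef_eq0.
by rewrite -[RHS]px horner_coef [in RHS](polySpred p0).
Qed.

Lemma conj_span a c : algebraic_over_center a -> algebraic_over_center a^-1 ->
  exists (I : finType) (s : I -> D), forall n, lspan Z s (cj (a ^+ n) c).
Proof.
move=> /alg_exp_span [m hm] /alg_exp_span [l hl].
exists ('I_l * 'I_m)%type, (fun ij : 'I_l * 'I_m => a^-1 ^+ ij.1 * c * a ^+ ij.2) => n.
rewrite /cj -exprVn; have [f hf ->] := hl n; have [g hg ->] := hm n.
exists (fun ij => f ij.1 * g ij.2); first by move=> ij; apply: (dsrM hZ).
rewrite !mulr_suml -(pair_bigA _ (fun i j => f i * g j * (a^-1 ^+ i * c * a ^+ j))) /=.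
apply: eq_bigr => i _; rewrite mulr_sumr; apply: eq_bigr => j _.
by rewrite -!mulrA; congr (_ * _); rewrite !mulrA -(hg j (a^-1 ^+ i * c)) !mulrA.
Qed.

Definition stable a := forall k y, (0 < k)%N -> GRing.comm y (a ^+ k) -> GRing.comm y a.

Lemma stableX a k : (0 < k)%N -> stable a -> stable (a ^+ k).
Proof.
move=> k0 ha l y l0; rewrite -exprM => h; apply: commrX.
by apply: (ha (k * l)%N) => //; rewrite muln_gt0 k0.
Qed.

Lemma stable_cj g a : g != 0 -> stable a -> stable (cj g a).
Proof.
move=> g0 ha k y k0; rewrite -cjX // => /commr_sym /(cj_commuting hD g0) /commr_sym.
move/(ha _ _ k0)/commr_sym => e; apply: commr_sym.
by rewrite -(cjVK hD g0 y); apply: cj_commute.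
Qed.

(* A power of [x] whose minimal polynomial has least degree generates the same field as all its own powers. *)
Lemma stable_power x : algebraic_over_center x -> exists2 m, (0 < m)%N & stable (x ^+ m).
Proof.
move=> /algebraicP [n0 hn0].
pose P n := exists2 m, (0 < m)%N & dependent Z (fun i : 'I_n => (x ^+ m) ^+ i).
have [n [[m m0 hm] nmin]] : exists n, P n /\ forall k, (k < n)%N -> ~ P k.
  have : P n0 by exists 1%N.
  elim/ltn_ind: n0 {hn0} => n ih Pn.
  have [[k [kn /(ih _ kn)]]|h] := classic (exists k, (k < n)%N /\ P k) => //.
  by exists n; split=> // k kn Pk; apply: h; exists k.
exists m => // k y k0 yk.
case: n hm nmin => [[c [_ [[]]]] //|n [c [hc c0 e]] nmin].
have cn : c ord_max != 0.
  apply/eqP => cn; apply: (nmin n) => //; exists m => //.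
  exists (fun i => c (widen_ord (leqnSn n) i)); split=> //; last first.
    by move: e; rewrite big_ord_recr /= cn mul0r addr0.
  case: c0 => i ci; case: (unliftP ord_max i) ci => [j|] ->; last by rewrite cn eqxx.
  by move=> cj0; exists j; congr (c _ != 0): cj0; apply/val_inj; rewrite /= /bump leqNgt ltn_ord.
(* [x ^+ m] and [n] powers of [x ^+ (m * k)] are n + 1 vectors in the span of n. If [x ^+ m] does
   not occur in the relation, minimality is contradicted; if it does, the relation solves for it. *)
pose v (i : 'I_n.+1) := if unlift ord0 i is Some j then (x ^+ m) ^+ (k * j) else x ^+ m.
have [|d [hd [i0 d0] ed]] := @dependentP Z hZ n (fun i => (x ^+ m) ^+ i) v.
  move=> i; have sp := exp_span hc cn e.
  by rewrite /v; case: unliftP => [j|] _; [apply: sp|apply: (sp 1%N)].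
rewrite big_ord_recl /v unlift_none in ed.
have {}ed : d ord0 * x ^+ m = - \sum_(i < n) d (lift ord0 i) * ((x ^+ m) ^+ k) ^+ i.
  apply/eqP; rewrite -addr_eq0 -[X in _ == X]ed; apply/eqP; congr (_ + _).
  by apply: eq_bigr => i _; rewrite liftK exprM.
have [dz|dnz] := eqVneq (d ord0) 0.
  case: (nmin n) => //; exists (m * k)%N; first by rewrite muln_gt0 m0.
  exists (fun i => d (lift ord0 i)); split=> //.
    by case: (unliftP ord0 i0) d0 => [j|] ->; [exists j|rewrite dz eqxx].
  apply: oppr_inj; rewrite oppr0 -[RHS](mul0r (x ^+ m)) -[X in _ = X * _]dz ed; congr (- _).
  by apply: eq_bigr => i _; rewrite !exprM.
apply: (mulrI_div hD dnz); rewrite [RHS]mulrA ed mulrA [d ord0 * y]hd -mulrA ed.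
apply/commrN/commr_sum => i _; apply: commrM; last exact: commrX.
by apply/commr_sym/hd.
Qed.

End Algebraic.


Section Stable.

Context (D : unitRingType) (hD : is_division_ring D).
Implicit Types (a b c g h t u v w x y z : D) (A B E G H K M P T : D -> Prop).

(* Dedekind's independence argument: a shortest relation between elements with distinct scalars could be shortened. *)
Lemma dedekind K P n (c : 'I_n -> D) (chi : D -> 'I_n -> D) :
  (forall x y, K x -> K y -> K (x - y)) -> (forall x y, K x -> K y -> K (x * y)) ->
  abelian_set K -> (forall t i, P t -> K (chi t i)) -> (forall i, c i != 0) ->
  (forall t (f : 'I_n -> D), P t -> (forall i, K (f i)) -> \sum_i f i * c i = 0 ->
     \sum_i f i * chi t i * c i = 0) ->
  forall f : 'I_n -> D, (forall i, K (f i)) -> (exists i, f i != 0) -> \sum_i f i * c i = 0 ->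
  exists i j, [/\ i != j, f i != 0, f j != 0 & forall t, P t -> chi t i = chi t j].
Proof.
move=> KB KM KC Kchi c0 rel f; have [m] := ubnP #|[set i | f i != 0]|.
elim: m f => // m ih f; rewrite ltnS => hm Kf [i fi] e.
have [j ji fj] : exists2 j, j != i & f j != 0.
  apply: NNPP => h; have : f i * c i = 0.
    rewrite -[RHS]e [RHS](bigD1 i) //= [X in _ + X]big1 ?addr0 // => j ji.
    have [->|fj] := eqVneq (f j) 0; first by rewrite mul0r.
    by case: h; exists j.
  by case/(mulf_eq0_div hD) => /eqP; rewrite ?(negbTE fi) ?(negbTE (c0 i)).
have [hij|hij] := classic (forall t, P t -> chi t i = chi t j).
  by exists i, j; rewrite eq_sym.
have [t [Pt hchi]] : exists t, P t /\ chi t i <> chi t j.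
  by apply: NNPP => h; apply: hij => t Pt; apply: NNPP => h'; apply: h; exists t.
pose g k := f k * (chi t k - chi t i).
have gf k : g k != 0 -> f k != 0.
  by apply: contra_neq => h; rewrite /g h mul0r.
have gi : g i = 0 by rewrite /g subrr mulr0.
have [||||p [q [pq gp gq hpq]]] := ih g.
- apply: leq_trans hm; apply: proper_card; apply/properP; split.
    by apply/subsetP => k; rewrite !inE; apply: gf.
  by exists i; rewrite !inE ?gi ?eqxx.
- by move=> k; apply: KM => //; apply: KB; apply: Kchi.
- exists j; apply: mulf_neq0_div => //; rewrite subr_eq0.
  by apply/eqP => h; apply: hchi.
- transitivity (\sum_k f k * chi t k * c k - chi t i * \sum_k f k * c k).
    rewrite mulr_sumr -sumrB; apply: eq_bigr => k _.
    by rewrite /g mulrBr mulrBl (mulrA (chi t i)) (KC (f k) (chi t i)) //; apply: Kchi.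
  by rewrite e mulr0 subr0; apply: rel.
by exists p, q; split=> //; apply: gf.
Qed.

(** Algebraicity makes two of the commuting conjugates agree, so some positive power of [a] commutes
    with [z]; stability removes the exponent. *)
Lemma stable_fix a z : a != 0 -> stable a -> algebraic_over_center z ->
  (forall i j, GRing.comm (cj (a ^+ i) z) (cj (a ^+ j) z)) -> GRing.comm z a.
Proof.
move=> a0 sa az hz; have [n hn] := conj_repeat hD az.
have hy (i : nat) : exists2 g, g != 0 & cj (a ^+ i) z = cj g z.
  by exists (a ^+ i) => //; apply: expf_neq0_div.
have [i [j [ij _ e]]] := hn (fun i => cj (a ^+ i) z) hy hz.
apply: (sa (j - i)%N); first by rewrite subn_gt0.
apply: (cj_fix hD); first exact: expf_neq0_div.
apply: (cj_inj hD (expf_neq0_div hD i a0)).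
by rewrite -cjMg ?expf_neq0_div // -exprD subnK // ltnW.
Qed.

Lemma divl_scale x y u : x != 0 -> u != 0 -> GRing.comm u (x^-1 * y) ->
  (x * u)^-1 * (y * u) = x^-1 * y.
Proof.
move=> x0 u0 e; rewrite invrM ?hD // -mulrA [x^-1 * _]mulrA -e mulrA.
by rewrite mulVr ?hD // mul1r.
Qed.

Lemma cent_inv T B t z : is_subgroup T -> inv_under T B -> T t -> cent B z -> cent B (cj t z).
Proof.
move=> hT hB Tt hz y By; have t0 := sg_neq0 hT Tt.
have : GRing.comm z (cj t^-1 y) by apply/hz/hB => //; apply: sgV.
by move/(cj_commute hD t0); rewrite cjVK.
Qed.

(* The conjugates of [c] by powers of [a] span a finite-dimensional space, so two of them agree modulo the centre of [B];
   then some power of [a] multiplies [c] by a central element, which has finite order, and [a] is stable. *)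
Lemma stable_cent_class2 T B a : is_subgroup T -> is_subgroup B -> (forall x, B x -> T x) ->
  inv_under T B -> algebraic_set T -> (forall x y, B x -> B y -> cent T (commutator x y)) ->
  T a -> stable a -> cent B a.
Proof.
move=> hT hB BT iB algT hcent Ta sa c Bc; apply: commr_sym.
have a0 := sg_neq0 hT Ta.
have Tan n : T (a ^+ n) by apply: sgX.
have [I [s hs]] := conj_span hD c (algT _ Ta) (algT _ (sgV hT Ta)).
pose v (i : 'I_#|I|.+1) := cj (a ^+ i) c.
have Bv i : B (v i) by apply: iB.
have [d [hd d0 ed]] : dependent (@center D) v.
  by apply: (dependent_fin hD (center_divsubring D)) => i; apply: hs.
(* Dedekind's argument needs scalars that commute with each other and with [B]. This choice contains
   both the centre of [D] and the commutators of [B]. *)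
pose K x := cent B x /\ cent (cent B) x.
have hC := cent_divsubring B; have hCC := cent_divsubring (cent B).
have KB x y : K x -> K y -> K (x - y).
  by move=> [? ?] [? ?]; split; [apply: (dsrB hC)|apply: (dsrB hCC)].
have KM x y : K x -> K y -> K (x * y).
  by move=> [? ?] [? ?]; split; [apply: (dsrM hC)|apply: (dsrM hCC)].
have abelK : abelian_set K by move=> x y [_ hx] [hy _]; apply: hx.
pose chi b i := commutator (v i) b.
have Kchi b i : B b -> K (chi b i).
  move=> Bb; split=> [y By|y Cy]; first by apply: hcent => //; apply: BT.
  by apply/commr_sym/Cy; apply: (sg_comm hB (Bv i) Bb).
have v0 i : v i != 0 by apply: (sg_neq0 hB).
have rel b (f : 'I_#|I|.+1 -> D) : B b -> (forall i, K (f i)) -> \sum_i f i * v i = 0 ->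
    \sum_i f i * chi b i * v i = 0.
  move=> Bb hf e; have b0 := sg_neq0 hB Bb.
  transitivity (cj b (\sum_i f i * v i)); last by rewrite e cj0.
  rewrite cj_sum; apply: eq_bigr => i _.
  rewrite cjM // (cj_comm hD b0); last by case: (hf i) => h _; apply: h.
  rewrite [cj b (v i)](cj_commutator hD) ?(sg_neq0 hB) // -mulrA.
  by congr (_ * _); apply: hcent => //; apply: BT.
have Kd i : K (d i) by split=> y _; apply: hd.
have [i [j [ij _ _ hij]]] := dedekind KB KM abelK Kchi v0 rel Kd d0 ed.
wlog ltij : i j ij hij / (i < j)%N.
  move=> H; have [] := ltngtP i j; first exact: H.
    by apply: H; rewrite 1?eq_sym // => t /hij.
  by move/val_inj => e; rewrite e eqxx in ij.
(* Conjugation by any [b] in [B] multiplies [v i] and [v j] by the same scalar, so their ratio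
   commutes with [B]. *)
pose z := (v i)^-1 * v j.
have Bz : B z by apply: sgM => //; apply: sgV.
have zB : cent B z.
  move=> b Bb; have b0 := sg_neq0 hB Bb; apply: (cj_fix hD b0).
  have hc : GRing.comm (chi b j) z by apply: hcent => //; apply: BT.
  have c0 : chi b j != 0 by apply: (sg_neq0 hB); apply: (sg_comm hB (Bv j) Bb).
  rewrite /z cjM // cjV // !(cj_commutator hD) ?(sg_neq0 hB) //.
  by rewrite -/(chi b i) -/(chi b j) hij //; apply: divl_scale.
have za : GRing.comm z a.
  apply: stable_fix => //; first by apply/algT/BT.
  by move=> k l; apply: (cent_inv hT iB (Tan k) zB); apply: iB.
have ek : cj (a ^+ (j - i)) c = c * z.
  have ai0 : a ^+ i != 0 by apply: expf_neq0_div.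
  suff -> : z = c^-1 * cj (a ^+ (j - i)) c by rewrite mulVKr // hD // (sg_neq0 hB).
  apply: (cj_inj hD ai0); rewrite (cj_comm hD ai0); last exact: commrX.
  rewrite cjM // cjV // -cjMg ?expf_neq0_div // -exprD subnK //; exact: ltnW.
apply: (sa (j - i)%N); first by rewrite subn_gt0.
apply: stable_fix.
- exact: expf_neq0_div.
- by apply: stableX => //; rewrite subn_gt0.
- by apply/algT/BT.
have ekn n : cj ((a ^+ (j - i)) ^+ n) c = c * z ^+ n.
  rewrite cj_expg ?expf_neq0_div //; elim: n => [|n ih]; first by rewrite mulr1.
  rewrite iterS ih cjM ?expf_neq0_div // ek cjX ?expf_neq0_div // cj_comm ?expf_neq0_div //.
    by rewrite -mulrA -exprS.
  exact: commrX.
move=> k l; rewrite !ekn.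
have zc : GRing.comm z c by apply: zB.
apply: commrM; apply: commr_sym; apply: commrM => //; try exact: commrX.
  by apply/commr_sym/commrX/commr_sym.
by apply/commrX/commr_sym/commrX.
Qed.

(** Climb the derived series of the solvable subgroup generated by [a] and [b] from its trivial
    term: once the derived subgroup of a term is central, [stable_cent_class2] makes both generators
    centralise that term. *)
Lemma stable_commute G a b : is_subgroup G -> algebraic_set G -> locally_solvable G ->
  G a -> G b -> stable a -> stable b -> GRing.comm a b.
Proof.
move=> hG algG lsG Ga Gb sa sb.
pose S x := x \in [:: a; b].
have SG x : S x -> G x by rewrite /S !inE => /orP [] /eqP ->.
have S0 x : S x -> x != 0 by move/SG/(sg_neq0 hG).
have hT := gen_subgroupP hD S0; set T := gen_subgroup S in hT.
have TG x : T x -> G x by apply; [|apply: SG].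
have [n hn] : is_solvable T by apply: lsG => x; apply: SG.
suff H k : (k <= n)%N -> forall x, iter (n - k) (@derived D) T x -> cent T x.
  by apply: (H n) => //; rewrite ?subnn; apply: sub_gen; rewrite /S !inE eqxx ?orbT.
elim: k => [|k ih] kn x.
  by rewrite subn0 => /hn -> y _; apply/commr_sym/commr1.
set B := iter _ _ _ => Bx y Ty.
have hB : is_subgroup B by apply: der_subgroup.
have BT z : B z -> T z by apply: (der_sub hD hT (leq0n _)).
have iB : inv_under T B by apply: der_inv => // g z; apply: sg_cj.
suff : cent B y by move=> /(_ _ Bx)/commr_sym.
apply: (gen_cent hD _ S0 Ty) => s Ss.
apply: (stable_cent_class2 hT) => //.
- by move=> z /TG/algG.
- move=> z w Bz Bw; apply: ih; first exact: ltnW.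
  by rewrite -(subSS k n) subSn //=; apply: derived_comm.
- exact: sub_gen.
- by move: Ss; rewrite /S !inE => /orP [] /eqP ->.
Qed.

End Stable.


(** * Solvable groups that are torsion modulo their centre *)

Section Torsion.

Context (D : unitRingType) (hD : is_division_ring D).
Implicit Types (a b c g h t u v w x y z : D) (A B E G H K M P T : D -> Prop).

Local Notation der n := (iter n (@derived D)).

(** Otherwise [y] and the [n] powers of [z] would be n + 1 distinct commuting roots of
    ['X^n - 1]. *)
Lemma prim_root_power n z y :
  n.-primitive_root z -> y ^+ n = 1 -> GRing.comm y z -> exists k, y = z ^+ k.
Proof.
move=> pz yn yz; have n0 := prim_order_gt0 pz; apply: NNPP => H.
pose rs := y :: mkseq (fun i => z ^+ i) n.
suff : (size rs < size ('X^n - 1 : {poly D})%R)%N.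
  by rewrite size_XnsubC //= size_mkseq ltnn.
have rootE x : root ('X^n - 1) x = (x ^+ n == 1).
  by rewrite /root hornerD hornerN hornerXn hornerC subr_eq0.
apply: max_ring_poly_roots.
- by rewrite -size_poly_eq0 size_XnsubC.
- rewrite /= rootE yn eqxx; apply/allP => _ /mapP [i _ ->].
  by rewrite rootE -exprM mulnC exprM (prim_expr_order pz) expr1n.
have: pairwise (@diff_roots D) rs.
  rewrite /=; apply/andP; split.
    apply/allP => _ /mapP [i _ ->]; rewrite /diff_roots (commrX i yz) eqxx /=.
    by apply: hD; rewrite subr_eq0; apply/eqP => e; apply: H; exists i.
  apply/(pairwiseP 0) => i j; rewrite !inE size_mkseq => hi hj ij.
  rewrite !nth_mkseq // /diff_roots -!exprD addnC eqxx /=; apply: hD.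
  by rewrite subr_eq0 (eq_prim_root_expr pz) !modn_small // gtn_eqF.
by elim: rs => //= x s ih /andP [-> /ih].
Qed.

Lemma prime_prim_root p z : prime p -> z ^+ p = 1 -> z != 1 -> p.-primitive_root z.
Proof.
case/primeP=> p1 dv zp z1.
have [m pm /dv /orP [] /eqP e] := prim_order_exists (ltnW p1) zp; last by rewrite -e.
by have := prim_expr_order pm; rewrite e expr1 => /eqP; rewrite (negbTE z1).
Qed.

Lemma derived_cent G a : is_subgroup G ->
  (forall x y, G x -> G y -> GRing.comm a (commutator x y)) ->
  forall x, derived G x -> GRing.comm a x.
Proof.
move=> hG h x dx; apply: commr_sym.
have hc y z : G y -> G z -> commutator y z != 0 /\ cent (eq a) (commutator y z).
  move=> Gy Gz; split; first by apply: (sg_neq0 hG); apply: sg_comm.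
  by move=> _ <-; apply/commr_sym/h.
by have [_] := derived_ind (sg_cent (nz_subgroup hD) (eq a)) hc dx; apply.
Qed.

(** Each conjugate of [t] is a root of unity commuting with [t], hence a power of [t], and power
    maps commute. *)
Lemma derived_cent_unity_root H A t n : is_subgroup H -> abelian_set A -> inv_under H A ->
  A t -> (0 < n)%N -> t ^+ n = 1 -> forall x, derived H x -> GRing.comm t x.
Proof.
move=> hH abA iA At n0 tn; have [m pm _] := prim_order_exists n0 tn.
have pw g : H g -> exists k, cj g t = t ^+ k.
  move=> Hg; have g0 := sg_neq0 hH Hg; apply: (prim_root_power pm).
    by rewrite -cjX // (prim_expr_order pm) cj1.
  by apply: abA => //; apply: iA.
apply: derived_cent => // x y Hx Hy.
have [[k ek] [l el]] := (pw _ (sgV hH Hx), pw _ (sgV hH Hy)).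
have [x0 y0] := (sg_neq0 hH Hx, sg_neq0 hH Hy).
apply: commutator_fix => //; rewrite ek el !cjX ?invr_neq0_div //.
by rewrite ek el -!exprM mulnC.
Qed.

(* [g |-> a^-1 a^g] takes values in the roots of unity of [A], on which [H] acts through an abelian group. *)
Lemma derived2_cent H A : is_subgroup H -> is_subgroup A -> abelian_set A -> inv_under H A ->
  (forall a, A a -> exists2 n, (0 < n)%N & cent H (a ^+ n)) ->
  forall x, der 2 H x -> cent A x.
Proof.
move=> hH hA abA iA tors x dx a Aa; apply: commr_sym.
have [n n0 an] := tors a Aa; have a0 := sg_neq0 hA Aa.
pose z g := a^-1 * cj g a.
have Az g : H g -> A (z g) by move=> Hg; apply: sgM => //; [apply: sgV|apply: iA].
have ez g : cj g a = a * z g by rewrite mulVKr // hD.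
have zn g : H g -> z g ^+ n = 1.
  move=> Hg; have g0 := sg_neq0 hH Hg.
  rewrite exprMn_comm; last by apply/commr_sym/commrV/abA => //; apply: iA.
  by rewrite -cjX // cj_comm // ?exprVn ?mulVr ?unitrX ?hD //; apply: an.
move: dx; apply: derived_cent; first exact: derived_subgroup.
move=> {}x y dx dy.
have dH := derived_sub hH.
have [x0 y0] := (sg_neq0 hH (dH _ dx), sg_neq0 hH (dH _ dy)).
have hdH := derived_subgroup hD hH.
have [dx' dy'] := (sgV hdH dx, sgV hdH dy).
have fix_z g h : derived H g -> derived H h -> cj g (z h) = z h.
  move=> dg dh; apply: cj_comm => //; first by apply/(sg_neq0 hdH).
  by apply: (derived_cent_unity_root hH abA iA _ n0) dg; [apply/Az/dH|apply/zn/dH].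
apply: commutator_fix => //; rewrite !ez.
rewrite (cjM hD (invr_neq0_div x0) a) (cjM hD (invr_neq0_div y0) a) !fix_z // !ez.
by rewrite -[LHS]mulrA -[RHS]mulrA; congr (_ * _); apply: abA; apply/Az/dH.
Qed.

(** Moving [a] to the left past [u ^+ n] costs [w ^+ n]; the costs add up to the binomial
    coefficient. *)
Lemma exp_class2 a u w n : u * a = w * (a * u) -> GRing.comm w a -> GRing.comm w u ->
  (a * u) ^+ n = a ^+ n * u ^+ n * w ^+ 'C(n, 2).
Proof.
move=> e wa wu.
have un k : u ^+ k * a = w ^+ k * (a * u ^+ k).
  elim: k => [|k ih]; first by rewrite !expr0 !mul1r mulr1.
  rewrite exprS -mulrA ih (mulrA u) (commrX k (commr_sym wu)) -mulrA (mulrA u a) e.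
  by rewrite (exprSr w) !mulrA.
elim: n => [|n ih]; first by rewrite !expr0 !mulr1.
have wX k y : GRing.comm w y -> w ^+ k * y = y * w ^+ k.
  by move=> h; apply/commr_sym/commrX/commr_sym.
have e1 : u ^+ n * (a * u) = a * u ^+ n.+1 * w ^+ n.
  rewrite mulrA un -mulrA -(mulrA a) -exprSr wX //.
  by apply: commrM => //; apply: commrX.
rewrite exprSr ih binS bin1 exprD -(mulrA _ (w ^+ _)) wX; last exact: commrM.
rewrite (mulrA _ _ (w ^+ 'C(n, 2))) -(mulrA (a ^+ n)) e1 (exprSr a) -!mulrA.
by do 3!congr (_ * _); rewrite -!exprD addnC.
Qed.

End Torsion.


(** * Groups of class 2: commutators and square roots of -1 *)

Section Class2.

Context (D : unitRingType) (hD : is_division_ring D).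
Implicit Types (a b c g h t u v w x y z : D) (A B E G H K M P T : D -> Prop).

Local Notation der n := (iter n (@derived D)).

Definition pm x y := x = y \/ x = - y.

Lemma pm_refl x : pm x x. Proof. by left. Qed.
Lemma pm_sym x y : pm x y -> pm y x.
Proof. by case=> ->; [left|right; rewrite opprK]. Qed.
Lemma pm_trans x y z : pm x y -> pm y z -> pm x z.
Proof. by case=> ->; [|case=> ->; [right|left; rewrite opprK]] => //; move=> h. Qed.
Lemma pm_cj g x y : pm x y -> pm (cj g x) (cj g y).
Proof. by case=> ->; [left|right; rewrite cjN]. Qed.
Lemma pm_cjI g x y : g != 0 -> pm (cj g x) (cj g y) -> pm x y.
Proof. by move=> g0 /(pm_cj g^-1); rewrite !cjK. Qed.
Lemma pm_comm x y z : pm x y -> GRing.comm y z -> GRing.comm x z.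
Proof. by case=> -> // h; apply/commr_sym/commrN/commr_sym. Qed.

Lemma pm_sqrN1 u v : u * u = -1 -> v * v = -1 -> GRing.comm u v -> pm u v.
Proof.
move=> uu vv uv; have: (u - v) * (u + v) = 0.
  by rewrite mulrDr !mulrBl uu vv uv opprK addrA subrK addNr.
case/(mulf_eq0_div hD) => /eqP; rewrite ?subr_eq0 ?addr_eq0 => /eqP ->.
  exact: pm_refl.
by right.
Qed.

Section Group.
Context (E : D -> Prop) (hE : is_subgroup E).
Hypothesis hcl : forall x y, E x -> E y -> cent E (commutator x y).

Lemma swap_class2 x y : E x -> E y -> exists2 w, E w /\ cent E w & x * y = w * (y * x).
Proof.
move=> Ex Ey; have [x0 y0] := (sg_neq0 hE Ex, sg_neq0 hE Ey).
exists (commutator x^-1 y^-1).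
  by split; [apply: sg_comm => //|apply: hcl]; apply: sgV.
by rewrite /commutator !invrK -!mulrA (mulKr (hD y0)) (mulVr (hD x0)) mulr1.
Qed.

(** For a prime p dividing [n], either a^(n/p) is noncentral and serves as [b], or the exponent
    drops to n/p. *)
Lemma prime_step a n : E a -> ~ cent E a -> (0 < n)%N -> cent E (a ^+ n) ->
  exists p b, [/\ prime p, E b, ~ cent E b & cent E (b ^+ p)].
Proof.
elim/ltn_ind: n => n ih Ea na n0 an.
have [n1|n1] := leqP n 1.
  by case: na; have e : n = 1%N by [apply/eqP; rewrite eqn_leq n1 n0]; rewrite e in an.
have pp := pdiv_prime n1; have pn := pdiv_dvd n.
have [h|h] := classic (cent E (a ^+ (n %/ pdiv n))).
  by apply: (ih (n %/ pdiv n)%N) => //; [apply: ltn_Pdiv => //; apply: prime_gt1|rewrite divn_gt0 ?pdiv_gt0 // pdiv_leq].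
exists (pdiv n), (a ^+ (n %/ pdiv n)); split=> //; first exact: sgX.
by rewrite -exprM divnK.
Qed.

(** [x] may lie outside [E]. As it fixes [a ^+ p], the conjugate a u of [a] has the same p-th power,
    and expanding (a u)^p gives the last equation. That [a ^+ p] commutes with u gives
    [w ^+ p = 1]. *)
Lemma commutator_relation a x p : E a -> cent E (a ^+ p) -> x != 0 -> E (cj x a) ->
  GRing.comm (a ^+ p) x ->
  exists2 w, (E w /\ cent E w) /\ w ^+ p = 1 &
    (commutator a x) * a = w * (a * commutator a x) /\
    (commutator a x) ^+ p * w ^+ 'C(p, 2) = 1.
Proof.
move=> Ea ap x0 Ex hx; set u := commutator a x; have a0 := sg_neq0 hE Ea.
have eu : cj x a = a * u by rewrite (cj_commutator hD).
have Eu : E u by rewrite /u commutatorE; apply: sgM => //; apply: sgV.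
have u0 := sg_neq0 hE Eu.
have [w [Ew cw] e] := swap_class2 Eu Ea.
have aX0 : a ^+ p != 0 by apply: expf_neq0_div.
have wp : w ^+ p = 1.
  have un k : u * a ^+ k = w ^+ k * (a ^+ k * u).
    elim: k => [|k ih]; first by rewrite !expr0 !mul1r mulr1.
    have wk : GRing.comm (w ^+ k) a by apply/commr_sym/commrX/commr_sym/cw.
    rewrite exprSr mulrA ih -mulrA -(mulrA (a ^+ k)) e (mulrA _ w) -(commrX k (cw _ Ea)).
    by rewrite (exprSr w) !mulrA.
  have := un p; rewrite -(ap _ Eu) => {}un.
  by apply: (mulIr_div hD (mulf_neq0_div hD aX0 u0)); rewrite -un mul1r.
exists w => //; split=> //.
apply: (mulrI_div hD aX0); rewrite mulr1 mulrA.
rewrite -(exp_class2 p e (cw _ Ea) (cw _ Eu)).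
by rewrite -eu -cjX // cj_comm.
Qed.

(* For odd [p] the commutator is itself a [p]-th root of unity, and all of these are powers of a central one. *)
Lemma commutator_cent_odd a x p : prime p -> odd p -> E a -> ~ cent E a -> cent E (a ^+ p) ->
  x != 0 -> E (cj x a) -> GRing.comm (a ^+ p) x -> E (commutator a x) /\ cent E (commutator a x).
Proof.
move=> pp op Ea na ap x0 Ex hx.
have [w [[Ew cw] wp] [_ up]] := commutator_relation Ea ap x0 Ex hx.
set u := commutator a x in up *.
have Eu : E u by rewrite /u commutatorE; apply: sgM => //; apply: sgV.
have {}up : u ^+ p = 1.
  have /dvdnP [k hk] : (p %| 'C(p, 2))%N.
    by apply: prime_dvd_bin => //; rewrite odd_prime_gt2.
  by move: up; rewrite hk mulnC exprM wp expr1n mulr1.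
have [e [Ee hae]] : exists e, E e /\ ~ GRing.comm a e.
  by apply: NNPP => H; apply: na => e Ee; apply: NNPP => H'; apply: H; exists e.
have e0 := sg_neq0 hE Ee.
have [w' [[Ew' cw'] w'p] [ew' _]] := commutator_relation Ea ap e0 (sg_cj hE Ee Ea) (ap _ Ee).
set u' := commutator a e in ew'.
have Eu' : E u' by apply: sg_comm.
have cu' : cent E u' by apply: hcl.
have u'p : u' ^+ p = 1.
  have a0 := sg_neq0 hE Ea; have aX0 := expf_neq0_div hD p a0.
  apply: (mulrI_div hD aX0); rewrite mulr1 -exprMn_comm; last by apply/commr_sym/cu'.
  by rewrite -(cj_commutator hD) // -cjX // cj_comm //; apply: ap.
have u'1 : u' != 1.
  apply/eqP => h; apply: hae; apply: (cj_fix hD e0).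
  by rewrite (cj_commutator hD) ?(sg_neq0 hE) // -/u' h mulr1.
have pr := prime_prim_root pp u'p u'1.
have [|k ->] := prim_root_power hD pr up; first by apply/commr_sym/cu'.
by split; [apply: sgX|move=> y Ey; apply/commr_sym/commrX/commr_sym/cu'].
Qed.

(** Here the binomial coefficient is 1 and w is 1 or -1, so the commutator squares to a sign. *)
Lemma commutator_two a x : E a -> cent E (a ^+ 2) -> x != 0 -> E (cj x a) ->
  GRing.comm (a ^+ 2) x -> pm (commutator a x) 1 \/ commutator a x * commutator a x = -1.
Proof.
move=> Ea a2 x0 Ex hx.
have [w [[Ew cw] w2] [_]] := commutator_relation Ea a2 x0 Ex hx.
rewrite binn expr1 expr2 in w2 *; move=> up.
have [w1|w1] := sqr_eq1_div hD w2; move: up; rewrite w1 ?mulr1 ?mulrN1.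
  by move/(sqr_eq1_div hD); left.
by move/eqP; rewrite eqr_oppLR => /eqP; right.
Qed.

Definition isQ u := E u /\ u * u = -1.

Lemma isQ_dichotomy u v : isQ u -> isQ v -> GRing.comm u v \/ u * v = - (v * u).
Proof.
move=> [Eu uu] [Ev vv]; have [w [Ew cw] e] := swap_class2 Eu Ev.
have v0 := sg_neq0 hE Ev; have u0 := sg_neq0 hE Eu.
have: w * w = 1.
  apply: (mulIr_div hD v0); rewrite mul1r; apply: oppr_inj.
  have -> : - v = u * (u * v) by rewrite mulrA uu mulN1r.
  rewrite e (mulrA u w) -(cw _ Eu) -(mulrA w u) (mulrA u v) e -!mulrA uu.
  by rewrite !mulrN mulr1 !mulrA.
by case/(sqr_eq1_div hD) => hw; rewrite hw ?mul1r ?mulN1r in e; [left|right].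
Qed.

Lemma isQ_mul u v : isQ u -> isQ v -> u * v = - (v * u) -> isQ (u * v).
Proof.
move=> [Eu uu] [Ev vv] e; split; first exact: sgM.
by rewrite {1}e mulNr -mulrA (mulrA u) uu mulN1r mulrN vv opprK.
Qed.

(** If [w] anticommutes with both [u] and [v], it commutes with [u * v]; commuting square roots of
    -1 agree up to sign. *)
Lemma isQ_three u v w : isQ u -> isQ v -> u * v = - (v * u) -> isQ w ->
  [\/ pm w u, pm w v | pm w (u * v)].
Proof.
move=> qu qv e qw.
have [h|wu] := isQ_dichotomy qw qu; first by constructor 1; apply: pm_sqrN1 => //; [case: qw|case: qu].
have [h|wv] := isQ_dichotomy qw qv; first by constructor 2; apply: pm_sqrN1 => //; [case: qw|case: qv].
constructor 3; have quv := isQ_mul qu qv e; apply: pm_sqrN1; [by case: qw|by case: quv|].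
by rewrite /GRing.comm mulrA wu mulNr -(mulrA u w) wv mulrN opprK mulrA.
Qed.
End Group.

End Class2.


(** * A uniform bound on the derived length *)

Section Bounded.

Context (D : unitRingType) (hD : is_division_ring D).
Implicit Types (a b c g h t u v w x y z : D) (A B E G H K M P T : D -> Prop).

Local Notation der n := (iter n (@derived D)).

Lemma commutator_Alt3 (s t : {perm 'I_3}) : [~ s, t]%g \in ('Alt_('I_3))%g.
Proof. by rewrite Alt_even !odd_permM !odd_permV; do 2!case: odd_perm. Qed.

Lemma Alt3_commutator (s t : {perm 'I_3}) :
  s \in ('Alt_('I_3))%g -> t \in ('Alt_('I_3))%g -> [~ s, t]%g = 1%g.
Proof.
move=> hs ht; have: cyclic ('Alt_('I_3))%g.
  apply: prime_cyclic; have := @card_Alt 'I_3; rewrite card_ord => /(_ isT).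
  by move/eqP; rewrite (_ : 3`! = 2 * 3)%N // eqn_pmul2l // => /eqP ->.
by move/cyclic_abelian/centsP/(_ _ hs _ ht)/commgP/eqP.
Qed.

(** [H] permutes the three lines through S_3, whose second derived subgroup is trivial. The relation
    [R] stands for this homomorphism. *)
Lemma lines_fixed (q : 'I_3 -> D) H : is_subgroup H ->
  (forall x i, H x -> exists j, pm (cj x (q i)) (q j)) ->
  (forall i j, pm (q i) (q j) -> i = j) ->
  forall x i, der 2 H x -> pm (cj x (q i)) (q i).
Proof.
move=> hH hq inj.
pose R x (s : {perm 'I_3}) := forall i, pm (cj x (q i)) (q (s i)).
have exR x : H x -> exists s, R x s.
  move=> Hx; have x0 := sg_neq0 hH Hx.
  have [f hf] := fin_all_exists (fun i => hq x i Hx).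
  have finj : injective f.
    move=> i j e; apply: inj; apply: (pm_cjI hD x0).
    by apply: pm_trans (hf i) _; rewrite e; apply: pm_sym.
  by exists (perm finj) => i; rewrite permE.
have RM x y (s t : {perm 'I_3}) : x != 0 -> y != 0 -> R x s -> R y t -> R (x * y) (s * t)%g.
  move=> x0 y0 hs ht i; rewrite cjMg // permM.
  by apply: pm_trans (ht _); apply: pm_cj.
have RV x s : x != 0 -> R x s -> R x^-1 s^-1%g.
  move=> x0 hs i; apply: (pm_cjI hD x0); rewrite cjVK //.
  by apply: pm_sym; have := hs (s^-1%g i); rewrite permKV.
have Rcomm x y (s t : {perm 'I_3}) : x != 0 -> y != 0 -> R x s -> R y t -> R (commutator x y) [~ s, t]%g.
  move=> x0 y0 hs ht; rewrite /commutator /commg /conjg -!mulrA.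
  have [x1 y1] := (invr_neq0_div x0, invr_neq0_div y0).
  have xy := mulf_neq0_div hD x0 y0.
  apply: (RM _ _ _ _ x1 (mulf_neq0_div hD y1 xy) (RV _ _ x0 hs)).
  exact: (RM _ _ _ _ y1 xy (RV _ _ y0 ht) (RM _ _ _ _ x0 y0 hs ht)).
(* Preimage of a permutation group, used with the alternating group for the first derivation and the
   trivial group for the second. *)
have Rsub (A : {group {perm 'I_3}}) :
    is_subgroup (fun x => x != 0 /\ exists2 s, s \in A & R x s).
  split.
  - split; first exact: oner_neq0.
    by exists 1%g => // i; rewrite cj1g perm1; apply: pm_refl.
  - by move=> x [].
  - move=> x y [x0 [s As Rs]] [y0 [t At Rt]]; split; first exact: mulf_neq0_div.
    by exists (s * t)%g; [apply: groupM|apply: RM].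
  - move=> x [x0 [s As Rs]]; split; first exact: invr_neq0_div.
    by exists s^-1%g; [rewrite groupV|apply: RV].
have hdH := derived_subgroup hD hH.
have d1 x : derived H x -> x != 0 /\ exists2 s, s \in ('Alt_('I_3))%g & R x s.
  apply: (derived_ind (Rsub _)) => {}x y Hx Hy; split.
    by apply: (sg_neq0 hH); apply: sg_comm.
  have [[s hs] [t ht]] := (exR _ Hx, exR _ Hy); exists [~ s, t]%g.
    exact: commutator_Alt3.
  by apply: Rcomm => //; apply: (sg_neq0 hH).
move=> x i dx.
have [_ [s]] : x != 0 /\ exists2 s, s \in [1 {perm 'I_3}]%G & R x s.
  move: x dx; apply: (derived_ind (Rsub _)) => x y Hx Hy; split.
    by apply: (sg_neq0 hdH); apply: (sg_comm hdH).
  have [[x0 [s As hs]] [y0 [t At ht]]] := (d1 _ Hx, d1 _ Hy); exists 1%g => //.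
  by rewrite -(Alt3_commutator As At); apply: Rcomm.
by rewrite inE => /eqP -> /(_ i); rewrite perm1.
Qed.

Lemma pm_commutator x y u : x != 0 -> y != 0 ->
  pm (cj x^-1 u) u -> pm (cj y^-1 u) u -> GRing.comm u (commutator x y).
Proof.
move=> x0 y0 hx hy; apply: commutator_fix => //.
by case: hx => ex; case: hy => ey; rewrite ex ey ?cjN ?ex ?ey.
Qed.

Section Cl2.
Context (H E : D -> Prop) (hH : is_subgroup H) (hE : is_subgroup E) (iE : inv_under H E).
Hypothesis hcl : forall x y, E x -> E y -> cent E (commutator x y).

Lemma isQ_inv x u : H x -> isQ E u -> isQ E (cj x u).
Proof.
move=> Hx [Eu uu]; have x0 := sg_neq0 hH Hx; split; first exact: iE.
by rewrite -cjM // uu cjN cj1.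
Qed.

(** If all square roots of -1 in [E] commute, a conjugate of [u] can only be [u] up to sign.
    Otherwise they form exactly three lines, which [H] permutes. *)
Lemma isQ_lines x u : der 2 H x -> isQ E u -> pm (cj x u) u.
Proof.
move=> dx qu; have Hx : H x by apply: (der_sub hD hH (leq0n 2)).
have [ab|nab] := classic (abelian_set (isQ E)).
  have qx := isQ_inv Hx qu.
  by apply: (pm_sqrN1 hD); [case: qx|case: qu|apply: ab].
have [a [b [qa qb nc]]] : exists a b, [/\ isQ E a, isQ E b & ~ GRing.comm a b].
  apply: NNPP => h; apply: nab => a b qa qb; apply: NNPP => h'.
  by apply: h; exists a, b.
have e : a * b = - (b * a) by case: (isQ_dichotomy hD hE hcl qa qb).
have qab := isQ_mul hE qa qb e.
pose q (i : 'I_3) := nth (a * b) [:: a; b] i.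
have qq i : isQ E (q i) by case: i => [[|[|[|]]]].
have q3 w : isQ E w -> exists j, pm w (q j).
  case/(isQ_three hD hE hcl qa qb e) => h.
  - by exists ord0.
  - by exists (@Ordinal 3 1 isT).
  - by exists (@Ordinal 3 2 isT).
have nca : ~ GRing.comm b a by move/commr_sym.
have ncq i j : pm (q i) (q j) -> GRing.comm (q i) (q j).
  by move=> h; apply: pm_comm h _.
have [a0 b0] := (sg_neq0 hE (proj1 qa), sg_neq0 hE (proj1 qb)).
have nab1 : ~ GRing.comm a (a * b).
  by move=> h; apply: nc; apply: (mulrI_div hD a0); rewrite h mulrA.
have nab2 : ~ GRing.comm b (a * b).
  by move=> h; apply: nc; apply: (mulIr_div hD b0); rewrite -[LHS]h mulrA.
have inj i j : pm (q i) (q j) -> i = j.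
  move/ncq => h; apply/val_inj; move: h.
  case: i => [[|[|[|]]]] //= ?; case: j => [[|[|[|]]]] //= ?; rewrite /q /= => h //;
  by exfalso; first [exact: nc h|exact: nc (commr_sym h)|exact: nab1 h|exact: nab2 h|
    exact: nab1 (commr_sym h)|exact: nab2 (commr_sym h)].
have [j hj] := q3 _ qu.
apply: pm_trans (pm_cj x hj) _; apply: pm_trans (pm_sym hj).
by apply: (lines_fixed hH) => // y i Hy; apply/q3/isQ_inv.
Qed.
End Cl2.

Lemma cent_center_sub H A : (forall x, A x -> H x) -> forall x, cent H x -> cent A x.
Proof. by move=> h x hx y /h; apply: hx. Qed.

(* Deep enough in the derived series, a class 2 term [E] centralises its elements of prime order modulo the centre:
   the only obstruction is a quaternion group of order 8, on whose three lines [H] acts through [S_3]. *)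
Lemma der_class2_central H i : is_subgroup H -> (3 <= i)%N ->
  (forall x, H x -> exists2 n, (0 < n)%N & cent H (x ^+ n)) ->
  (forall x, der i.+1 (der 2 H) x -> cent (der 2 H) x) ->
  forall x, der i (der 2 H) x -> cent (der 2 H) x.
Proof.
move=> hH i3 tors; set B := der 2 H => hB1.
have hB : is_subgroup B by apply: der_subgroup.
have BH x : B x -> H x by apply: (der_sub hD hH (leq0n 2)).
set E := der i B; have hE : is_subgroup E by apply: der_subgroup.
have iB : inv_under H B by apply: der_inv => // g z; apply: sg_cj.
have iE : inv_under H E by apply: der_inv.
have Ej j x : (j <= i)%N -> E x -> der j B x by move=> ji; apply: der_sub.
have EB x : E x -> B x by apply: (Ej 0%N).
have hcl x y : E x -> E y -> cent E (commutator x y).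
  move=> Ex Ey; apply: (cent_center_sub EB); apply: hB1.
  exact: derived_comm.
(* By [derived2_cent], [B] centralises each abelian subgroup of [E] that [H] normalises. *)
have cBA A : is_subgroup A -> (forall x, A x -> E x) -> abelian_set A -> inv_under H A ->
    forall a, A a -> cent B a.
  move=> hA AE abA iA a Aa b Bb; apply/commr_sym.
  by apply: (derived2_cent hD hH hA abA iA _ Bb) => // y /AE/EB/BH; apply: tors.
have cBZ a : E a -> cent E a -> cent B a.
  move=> Ea ca; apply: (cBA (fun x => E x /\ cent E x)) => //.
  - exact: sg_cent.
  - by move=> x [].
  - by move=> x y [_ hx] [Ey _]; apply: hx.
  - by move=> g x Hg [Ex cx]; split; [apply: iE|apply: (cent_inv hD hH)].
suff abE : abelian_set E by move=> x Ex; apply: (cBA E).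
apply: NNPP => nabE.
have [a0 [Ea0 na0]] : exists a, E a /\ ~ cent E a.
  by apply: NNPP => h; apply: nabE => x y Ex; apply: NNPP => h'; apply: h; exists x; split=> // /(_ y).
have [n n0 an] := tors _ (BH _ (EB _ Ea0)).
have anE : cent E (a0 ^+ n) by apply: cent_center_sub an => x /EB/BH.
have [p [a [pp Ea na ap]]] := prime_step hE Ea0 na0 n0 anE.
have {Ea0 na0 n0 an anE} apB : cent B (a ^+ p) by apply: cBZ => //; apply: sgX.
have aN0 := sg_neq0 hE Ea.
have Ba x : B x -> cj x a = a * commutator a x.
  by move=> Bx; rewrite (cj_commutator hD).
(* If the commutators [a, x] with x in [K] commute and are fixed by [K], then [K] moves [a] by
   commuting translations and its derived subgroup fixes [a]. *)
have fix_sub K : is_subgroup K -> (forall x, K x -> B x) ->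
    (forall x y, K x -> K y -> cj y (commutator a x) = commutator a x /\ GRing.comm (commutator a x) (commutator a y)) ->
    forall x, derived K x -> GRing.comm a x.
  move=> hK KB h; apply: derived_cent => // x y Kx Ky.
  have [Kx' Ky'] := (sgV hK Kx, sgV hK Ky).
  have [x0 y0] := (sg_neq0 hK Kx', sg_neq0 hK Ky').
  apply: (commutator_fix hD (sg_neq0 hK Kx) (sg_neq0 hK Ky)); rewrite !Ba; try exact: KB.
  rewrite [LHS](cjM hD x0 a) [RHS](cjM hD y0 a) !Ba; try exact: KB.
  have [-> cxy] := h _ _ Ky' Kx'; have [-> _] := h _ _ Kx' Ky'.
  by rewrite -[LHS]mulrA -[RHS]mulrA; congr (_ * _); apply: esym cxy.
apply: (na) => e Ee.
have [p2|op] := even_prime pp; last first.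
  apply: (fix_sub B) => //; last by apply: (Ej 1%N) => //; apply: leq_trans i3.
  move=> x y Bx By.
  have cz z : B z -> cent B (commutator a z).
    move=> Bz; have [] := commutator_cent_odd hD hE hcl pp op Ea na ap (sg_neq0 hB Bz) (iE _ _ (BH _ Bz) Ea) (apB _ Bz).
    exact: cBZ.
  split; first by apply: cj_comm => //; [apply: (sg_neq0 hB)|apply: cz].
  by apply: cz => //; apply: (sg_comm hB) => //; apply: EB.
rewrite {p}p2 in ap apB pp.
have caseu x : B x -> pm (commutator a x) 1 \/ isQ E (commutator a x).
  move=> Bx; have [] := commutator_two hD hE hcl Ea ap (sg_neq0 hB Bx) (iE _ _ (BH _ Bx) Ea) (apB _ Bx).
    by left.
  move=> h; right; split=> //; rewrite commutatorE; apply: sgM => //; first exact: sgV.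
  by apply: iE => //; apply: BH.
have hB' : is_subgroup (der 1 B) by apply: der_subgroup.
have B1B x : der 1 B x -> B x by apply: (der_sub hD hB (leq0n 1)).
have fixu x z : B x -> der 1 B z -> GRing.comm (commutator a x) z.
  move=> Bx; case: (caseu x Bx) => [h|qu].
    by move=> _; apply: (pm_comm h); apply/commr_sym/commr1.
  apply: derived_cent => // y y' By By'.
  by apply: pm_commutator; rewrite ?(sg_neq0 hB) //; apply: (isQ_lines hH hE iE hcl) => //; apply: (sgV hB).
(* The derived subgroup of [B] fixes all these commutators, so on it x -> [a, x] is an
   antihomomorphism into [E]. *)
have mulu x y : der 1 B x -> der 1 B y ->
    commutator a (x * y) = commutator a y * commutator a x.
  move=> dx dy; have [x0 y0] := (sg_neq0 hB' dx, sg_neq0 hB' dy).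
  have [Bx By] := (B1B _ dx, B1B _ dy).
  apply: (mulrI_div hD aN0); rewrite -(Ba _ (sgM hB Bx By)) cjMg // (Ba _ Bx).
  rewrite (cjM hD y0) (Ba _ By) (cj_comm hD y0) ?mulrA //.
  exact: fixu.
have Eu x : B x -> E (commutator a x).
  move=> Bx; rewrite commutatorE; apply: sgM => //; first exact: sgV.
  by apply: iE => //; apply: BH.
(* Preimage of the centre of [E] under this map. Since [E] has class 2, it contains the commutators
   of [der 1 B], hence [der 2 B]. *)
have hS : is_subgroup (fun x => der 1 B x /\ cent E (commutator a x)).
  have hC := cent_divsubring E; split.
  - split; first exact: (sg1 hB').
    by rewrite commutatorE cj1g mulVr ?hD //; exact: (dsr1 hC).
  - by move=> x [/(sg_neq0 hB')].
  - move=> x y [dx cx] [dy cy]; split; first exact: (sgM hB').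
    by rewrite mulu //; apply: (dsrM hC).
  - move=> x [dx cx]; have dx' := sgV hB' dx; split=> //.
    have x0 := sg_neq0 hB' dx; have ux0 := sg_neq0 hE (Eu _ (B1B _ dx)).
    suff -> : commutator a x^-1 = (commutator a x)^-1 by apply: (dsrV hC).
    apply: (mulIr_div hD ux0); rewrite -mulu // mulrV ?mulVr ?hD //.
    by rewrite commutatorE cj1g mulVr ?hD.
have B2S x : der 2 B x -> der 1 B x /\ cent E (commutator a x).
  apply: (derived_ind hS) => {}x y dx dy; have dc := sg_comm hB' dx dy; split=> //.
  have [Ex Ey] := (Eu _ (B1B _ dx), Eu _ (B1B _ dy)).
  have [w [Ew cw] ew] := swap_class2 hD hE hcl Ey Ex.
  suff -> : commutator a (commutator x y) = w by [].
  have [x0 y0] := (sg_neq0 hB' dx, sg_neq0 hB' dy).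
  apply: (mulIr_div hD (mulf_neq0_div hD (sg_neq0 hE Ex) (sg_neq0 hE Ey))).
  rewrite -ew -(mulu y x) // -(mulu x y) // -(mulu (y * x)) //; last exact: (sgM hB').
  by congr (commutator a _); rewrite /commutator -!mulrA !mulVKr ?hD.
have hB2 : is_subgroup (der 2 B) by apply: der_subgroup.
(* The third derivation: [der 3 B] fixes [a], and [3 <= i] puts [E] inside [der 3 B], so [a] would
   be central in [E]. *)
apply: (fix_sub (der 2 B)) => //; [|  |exact: (Ej 3%N)].
- by move=> x /B2S [/B1B].
move=> x y /B2S [dx cx] /B2S [dy cy]; have [Bx By] := (B1B _ dx, B1B _ dy); split.
  by apply: cj_comm => //; [apply: (sg_neq0 hB)|apply: cBZ => //; apply: Eu].
by apply: cx; apply: Eu.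
Qed.

Lemma torsion_solvable_bounded H k : is_subgroup H ->
  (forall x, H x -> exists2 n, (0 < n)%N & cent H (x ^+ n)) ->
  (forall x, der k H x -> x = 1) -> forall x, der 6 H x -> x = 1.
Proof.
move=> hH tors hk; set B := der 2 H.
have hB : is_subgroup B by apply: der_subgroup.
(* Ascent from a trivial term to [der 3 B]. The subtraction is truncated, so the claim no longer
   changes once [i] reaches [k]. *)
have H3 i : forall x, der (3 + (k - i)) B x -> cent B x.
  elim: i => [|i ih] x.
    rewrite subn0 -iterD => hx.
    have -> : x = 1 by apply: hk; apply: (der_sub hD hH _ hx); rewrite addnAC leq_addl.
    by move=> y _; apply/commr_sym/commr1.
  have [ki|ik] := leqP k i.
    by move=> h; apply: ih; move: h; rewrite (eqP (ki : (k - i == 0)%N)) subnS (eqP (ki : (k - i == 0)%N)).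
  apply: (der_class2_central hH) => // y; rewrite -addnS -subSn // subSS; exact: ih.
have {}H3 x : der 3 B x -> cent B x by have := @H3 k x; rewrite subnn.
have one : is_subgroup (fun x : D => x = 1).
  by split=> // [_ ->|_ _ -> ->|_ ->]; rewrite ?oner_neq0 ?mulr1 ?invr1.
have hB3 : is_subgroup (der 3 B) by apply: der_subgroup.
move=> x; rewrite -[6%N]/(4 + 2)%N iterD => hx.
apply: (derived_ind one) hx => {}x y Bx By.
have x0 := sg_neq0 hB3 Bx.
rewrite commutatorE cj_comm ?(sg_neq0 hB3) ?mulVr ?hD //.
by apply: H3 => //; apply: (der_sub hD hB (leq0n 3)).
Qed.

(** Carries a uniform bound on derived length from finitely generated subgroups to the whole
    group. *)
Lemma der_gen_finite n G x : is_subgroup G -> der n G x ->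
  exists2 s : seq D, (forall y, y \in s -> G y) & der n (gen_subgroup (fun y => y \in s)) x.
Proof.
move=> hG; elim: n x => [|n ih] x.
  move=> Gx; exists [:: x]; first by move=> y; rewrite inE => /eqP ->.
  by apply: sub_gen; rewrite inE.
have genP (s : seq D) : (forall y, y \in s -> G y) -> is_subgroup (gen_subgroup (fun y => y \in s)).
  by move=> sG; apply: (gen_subgroupP hD) => y /sG/(sg_neq0 hG).
have wid m (s s' : seq D) y : {subset s <= s'} ->
    der m (gen_subgroup (fun y => y \in s)) y -> der m (gen_subgroup (fun y => y \in s')) y.
  by move=> ss'; apply: der_mono => z; apply: gen_mono.
have catG (s t : seq D) : (forall y, y \in s -> G y) -> (forall y, y \in t -> G y) ->
    forall y, y \in s ++ t -> G y.
  by move=> sG tG y; rewrite mem_cat => /orP []; [apply: sG|apply: tG].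
have sl (s t : seq D) : {subset s <= s ++ t} by move=> y ys; rewrite mem_cat ys.
have sr (s t : seq D) : {subset t <= s ++ t} by move=> y ys; rewrite mem_cat ys orbT.
have derP (s : seq D) : (forall y, y \in s -> G y) ->
    is_subgroup (der n.+1 (gen_subgroup (fun y => y \in s))).
  by move=> sG; apply: (der_subgroup hD (genP _ sG)).
rewrite iterS; move: x; apply: derived_ind.
  split.
  - have nG : forall y, y \in [::] -> G y by [].
    by exists [::] => //; apply: (sg1 (derP _ nG)).
  - by move=> y [s sG]; apply: (sg_neq0 (derP _ sG)).
  - move=> y z [s sG ys] [t tG zt]; have stG := catG _ _ sG tG.
    exists (s ++ t) => //; apply: (sgM (derP _ stG)).
      exact: (wid n.+1 _ _ _ (sl s t)).
    exact: (wid n.+1 _ _ _ (sr s t)).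
  - by move=> y [s sG ys]; exists s => //; apply: (sgV (derP _ sG)).
move=> y z /ih [s sG ys] /ih [t tG zt]; have stG := catG _ _ sG tG.
exists (s ++ t) => //; apply: derived_comm.
  exact: (wid n _ _ _ (sl s t)).
exact: (wid n _ _ _ (sr s t)).
Qed.

Lemma torsion_locally_solvable_bounded G : is_subgroup G -> locally_solvable G ->
  (forall x, G x -> exists2 n, (0 < n)%N & cent G (x ^+ n)) ->
  forall x, der 6 G x -> x = 1.
Proof.
move=> hG lsG tors x /(der_gen_finite hG) [s sG hx].
have hH : is_subgroup (gen_subgroup (fun y => y \in s)).
  by apply: (gen_subgroupP hD) => y /sG/(sg_neq0 hG).
have HG y : gen_subgroup (fun y => y \in s) y -> G y by apply.
have [k hk] := lsG s sG.
apply: (torsion_solvable_bounded hH _ hk hx) => y /HG/tors [n n0 yn].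
by exists n => // z /HG; apply: yn.
Qed.

End Bounded.


(** * The dichotomy for locally solvable algebraic normal subgroups *)

Section Main.

Context (D : unitRingType) (hD : is_division_ring D).
Implicit Types (a b c g h t u v w x y z : D) (A B E G H K M P T : D -> Prop).

Local Notation der n := (iter n (@derived D)).

Lemma last_derived P n G : (forall x, der n G x -> P x) -> (forall x, G x -> P x) \/
  exists i, (exists x, der i G x /\ ~ P x) /\ forall x, der i.+1 G x -> P x.
Proof.
elim: n => [|n ih] hn; first by left.
have [h|h] := classic (forall x, der n G x -> P x); first exact: ih.
right; exists n; split=> //; apply: NNPP => h'; apply: h => x hx.
by apply: NNPP => h; apply: h'; exists x.
Qed.

(** The noncentral elements of the quaternion group; 1 and -1 are left out. *)
Definition in_Q8 u v w := [\/ pm w u, pm w v | pm w (u * v)].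

(** Algebraicity is known only for a derived subgroup [G], while normality and centrality refer to
    the group [T] around it: [M] itself, or the units of a division subring in Hua's theorem. *)
Lemma solvable_normal_dichotomy T G : is_subgroup T -> is_subgroup G ->
  (forall x, G x -> T x) -> inv_under T G -> algebraic_set G -> locally_solvable G ->
  (forall A, is_subgroup A -> (forall x, A x -> G x) -> abelian_set A -> inv_under T A ->
     forall a, A a -> cent T a) ->
  (forall x, G x -> cent T x) \/
  exists u v, [/\ G u /\ G v, u * u = -1, v * v = -1, u * v = - (v * u) /\ ~ GRing.comm u v &
    forall x w, T x -> in_Q8 u v w -> in_Q8 u v (cj x w)].
Proof.
move=> hT hG GT iG algG lsG ab.
(* A commuting family normalised by [T] generates an abelian normal subgroup, hence is central.
   Applied below to stable elements, to the conjugates of [a] and to square roots of -1. *)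
have genab (S : D -> Prop) : (forall x, S x -> G x) -> abelian_set S -> inv_under T S ->
    forall x, S x -> cent T x.
  move=> SG abS iS x Sx; have S0 y : S y -> y != 0 by move/SG/(sg_neq0 hG).
  apply: (ab (gen_subgroup S)) (sub_gen Sx).
  - exact: gen_subgroupP.
  - by move=> y; apply.
  - exact: gen_abelian.
  - exact: gen_inv.
have tors x : G x -> exists2 n, (0 < n)%N & cent T (x ^+ n).
  move=> Gx; have [m m0 sm] := stable_power hD (algG _ Gx); exists m => //.
  apply: (genab (fun y => G y /\ stable y)) => [y [] //|y z [Gy sy] [Gz sz]|g y Tg [Gy sy]|].
  - exact: (stable_commute hD hG).
  - by split; [apply: iG|apply: stable_cj => //; apply: (sg_neq0 hT)].
  - by split=> //; apply: sgX.
have tG x : G x -> exists2 n, (0 < n)%N & cent G (x ^+ n).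
  by move=> /tors [n n0 h]; exists n => //; apply: cent_center_sub h.
have d6 x : der 6 G x -> cent T x.
  move=> hx; rewrite (torsion_locally_solvable_bounded hD hG lsG tG hx) => y _.
  exact/commr_sym/commr1.
have [|[i [[e0 [Ee0 ne0]] hi]]] := last_derived d6; first by left.
right; set E := der i G in Ee0.
have hE : is_subgroup E by apply: der_subgroup.
have iE : inv_under T E by apply: der_inv.
have EG x : E x -> G x by apply: (der_sub hD hG (leq0n _)).
have ET x : E x -> T x by move/EG/GT.
have hcl x y : E x -> E y -> cent E (commutator x y).
  by move=> Ex Ey; apply: (cent_center_sub ET); apply: hi; apply: derived_comm.
have cEZ x : E x -> cent E x -> cent T x.
  move=> Ex cx; apply: (ab (fun x => E x /\ cent E x)) (conj Ex cx).
  - exact: sg_cent.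
  - by move=> y [/EG].
  - by move=> y z [_ cy] [Ez _]; apply: cy.
  - by move=> g y Tg [Ey cy]; split; [apply: iE|apply: (cent_inv hD hT)].
have nce0 : ~ cent E e0 by move/(cEZ _ Ee0).
have [n n0 hn] := tors _ (EG _ Ee0).
have hnE : cent E (e0 ^+ n) by apply: cent_center_sub hn.
have [p [a [pp Ea na ap]]] := prime_step hE Ee0 nce0 n0 hnE.
have {}apT : cent T (a ^+ p) by apply: cEZ => //; apply: sgX.
have aN0 := sg_neq0 hE Ea.
have Eu x : T x -> E (commutator a x).
  by move=> Tx; rewrite commutatorE; apply: (sgM hE); [apply: sgV|apply: iE].
(* If all these commutators were central, the conjugates of [a] would commute with each other and
   [a] would be central. *)
have [x [Tx nx]] : exists x, T x /\ ~ cent T (commutator a x).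
  apply: NNPP => H.
  have H' x : T x -> cent T (commutator a x).
    by move=> Tx; apply: NNPP => H'; apply: H; exists x.
  have ex x : T x -> cj x a = a * commutator a x by move=> Tx; rewrite (cj_commutator hD).
  apply: na; apply: (cent_center_sub ET).
  apply: (genab (fun y => exists2 x, T x & y = cj x a)).
  - by move=> _ [x Tx ->]; apply/EG/iE.
  - move=> _ _ [x Tx ->] [y Ty ->]; rewrite !ex //.
    have [cx cy] := (H' _ Tx, H' _ Ty).
    have Ta := ET _ Ea; have Tc z : T z -> T (commutator a z) by move/Eu/ET.
    apply: commrM; last by apply/commr_sym/cy; apply: (sgM hT) => //; apply: Tc.
    by apply: commr_sym; apply: commrM => //; apply/commr_sym/cx.
  - move=> g _ Tg [x Tx ->]; exists (x * g); first exact: sgM.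
    by rewrite cjMg ?(sg_neq0 hT).
  - by exists 1; [apply: sg1|rewrite cj1g].
have x0 := sg_neq0 hT Tx.
have [p2|op] := even_prime pp; last first.
  have [_] := commutator_cent_odd hD hE hcl pp op Ea na ap x0 (iE _ _ Tx Ea) (apT _ Tx).
  by move=> h; case: nx; apply: cEZ => //; apply: Eu.
rewrite {p}p2 in ap apT pp.
have [h|uu] := commutator_two hD hE hcl Ea ap x0 (iE _ _ Tx Ea) (apT _ Tx).
  by case: nx => y _; apply: (pm_comm h); apply/commr_sym/commr1.
have [b [c [qb qc nc]]] : exists b c, [/\ isQ E b, isQ E c & ~ GRing.comm b c].
  apply: NNPP => H; apply: nx; apply: (genab (isQ E)).
  - by move=> y [/EG].
  - by move=> y z qy qz; apply: NNPP => H'; apply: H; exists y, z.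
  - by move=> g y; apply: (isQ_inv hD hT iE).
  - by split=> //; apply: Eu.
have e : b * c = - (c * b) by case: (isQ_dichotomy hD hE hcl qb qc).
exists b, c; split=> //; [by split; apply: EG; [case: qb|case: qc]|by case: qb|by case: qc|].
move=> y w Ty qw; apply: (isQ_three hD hE hcl qb qc e).
apply: (isQ_inv hD hT iE Ty).
have pmQ w1 w2 : pm w1 w2 -> isQ E w2 -> isQ E w1.
  case=> -> // [Ew ww]; split; last by rewrite mulrNN.
  have <- : w2 * (w2 * w2) = - w2 by rewrite ww mulrN1.
  by do 2?apply: (sgM hE).
case: qw => /pmQ; apply=> //; exact: (isQ_mul hE).
Qed.

End Main.


(** * Integer quaternions *)

(* [(a, b, c, d)] stands for [a + b i + c j + d k]. *)
Definition quat : Type := (int * int * int * int)%type.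
Definition mulq (s t : quat) : quat :=
  let: (a, b, c, d) := s in let: (a', b', c', d') := t in
  (a * a' - b * b' - c * c' - d * d', a * b' + b * a' + c * d' - d * c',
   a * c' - b * d' + c * a' + d * b', a * d' + b * c' - c * b' + d * a').
Definition subq (s t : quat) : quat :=
  let: (a, b, c, d) := s in let: (a', b', c', d') := t in (a - a', b - b', c - c', d - d').
Definition conjq (s : quat) : quat := let: (a, b, c, d) := s in (a, - b, - c, - d).
Definition normq (s : quat) : int :=
  let: (a, b, c, d) := s in a * a + b * b + c * c + d * d.

Lemma normqM s t : normq (mulq s t) = normq s * normq t.
Proof. by case: s => [[[a b] c] d]; case: t => [[[a' b'] c'] d'] /=; ring. Qed.
Lemma normq_conj s : normq (conjq s) = normq s.
Proof. by case: s => [[[a b] c] d] /=; ring. Qed.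
Lemma mulq_conj s : mulq s (conjq s) = (normq s, 0, 0, 0).
Proof. by case: s => [[[a b] c] d] /=; congr (_, _, _, _); ring. Qed.

Definition units8 : seq quat :=
  [:: (0, 1, 0, 0); (0, -1, 0, 0); (0, 0, 1, 0); (0, 0, -1, 0); (0, 0, 0, 1); (0, 0, 0, -1)].
(* Representatives of the 24 automorphisms of the quaternion group, each realised by conjugation. *)
Definition units24 : seq quat :=
  [:: (1, 0, 0, 0); (0, 1, 0, 0); (0, 0, 1, 0); (0, 0, 0, 1);
      (1, 1, 0, 0); (1, -1, 0, 0); (1, 0, 1, 0); (1, 0, -1, 0); (1, 0, 0, 1); (1, 0, 0, -1);
      (0, 1, 1, 0); (0, 1, -1, 0); (0, 1, 0, 1); (0, 1, 0, -1); (0, 0, 1, 1); (0, 0, 1, -1);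
      (1, 1, 1, 1); (1, 1, 1, -1); (1, 1, -1, 1); (1, 1, -1, -1);
      (1, -1, 1, 1); (1, -1, 1, -1); (1, -1, -1, 1); (1, -1, -1, -1)].

(** Conjugation by [e] sends i to [s] and j to [t]. The norms 1, 2, 4 are squares or twice squares,
    the condition that will define a proper subgroup containing [M]. *)
Definition realises (s t e : quat) : bool :=
  [&& mulq (0, 1, 0, 0) e == mulq e s, mulq (0, 0, 1, 0) e == mulq e t
    & normq e \in [:: 1; 2; 4]].

Lemma units24P : all (fun s => all (fun t =>
  (mulq s t == mulq t s) || has (realises s t) units24) units8) units8.
Proof. by vm_compute. Qed.

(** Pigeonhole: squaring is at most two-to-one, so the squares and their images under y -> -1 - y
    each fill at least half of the p elements; as p is odd, they meet. *)
Lemma sum_sqr_Fp p : prime p -> odd p -> exists a b : 'F_p, a ^+ 2 + b ^+ 2 + 1 = 0.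
Proof.
move=> pp op; pose S := [set x ^+ 2 | x : 'F_p]; pose T := [set -1 - y | y in S].
have cardT : #|T| = #|S| by apply: card_imset => x y /addrI /oppr_inj.
have cardS : (p <= 2 * #|S|)%N.
  apply: (@leq_trans (\sum_(y in S) 2)%N); last by rewrite sum_nat_const mulnC.
  rewrite -{1}(card_Fp pp) -sum1_card.
  rewrite (partition_big (fun x : 'F_p => x ^+ 2) (mem S)) /=; last first.
    by move=> x _; apply/imsetP; exists x.
  apply: leq_sum => y /imsetP [x0 _ ->].
  rewrite sum1_card; apply: (@leq_trans #|[set x0; - x0]|).
    apply/subset_leq_card/subsetP => x h.
    by rewrite !inE -eqf_sqr; apply: h.
  by rewrite cards2; case: eqP.
have [z] : exists z, z \in S :&: T.
  apply/set0Pn; apply/negP => /eqP e.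
  have := cardsUI S T; rewrite e cards0 addn0 cardT addnn -mul2n => h.
  have : (#|S :|: T| <= #|'F_p|)%N by apply: max_card.
  rewrite card_Fp // h => h2; have e2 : p = (2 * #|S|)%N by apply/eqP; rewrite eqn_leq cardS h2.
  by move: op; rewrite e2 mul2n odd_double.
rewrite inE => /andP [/imsetP [a _ ->] /imsetP [_ /imsetP [b _ ->] e]].
by exists a, b; rewrite e; ring.
Qed.

Section Quaternions.

Context (D : unitRingType) (hD : is_division_ring D).
Implicit Types (g h w x y z : D) (A B E G H K M P T : D -> Prop).
Context (u v : D) (uu : u * u = -1) (vv : v * v = -1) (uv : u * v = - (v * u))
  (nc : ~ GRing.comm u v).

Definition Qz (s : quat) : D :=
  let: (a, b, c, d) := s in a%:~R + b%:~R * u + c%:~R * v + d%:~R * (u * v).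

Lemma Qz1 : Qz (1, 0, 0, 0) = 1.
Proof. by rewrite /= !mulr0z !mul0r !addr0 mulr1z. Qed.
Lemma Qzu : Qz (0, 1, 0, 0) = u.
Proof. by rewrite /= !mulr0z !mul0r !addr0 mulr1z mul1r add0r. Qed.
Lemma Qzv : Qz (0, 0, 1, 0) = v.
Proof. by rewrite /= !mulr0z !mul0r !addr0 mulr1z mul1r !add0r. Qed.
Lemma Qzint (a : int) : Qz (a, 0, 0, 0) = a%:~R.
Proof. by rewrite /= !mulr0z !mul0r !addr0. Qed.

Lemma QzB s t : Qz (subq s t) = Qz s - Qz t.
Proof.
case: s => [[[a b] c] d]; case: t => [[[a' b'] c'] d'] /=.
rewrite !rmorphB /= !mulrBl !opprD.
by do 3!(rewrite [RHS]addrACA; congr (_ + _)).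
Qed.

Lemma QzM s t : Qz (mulq s t) = Qz s * Qz t.
Proof.
case: s => [[[a b] c] d]; case: t => [[[a' b'] c'] d'].
pose k := u * v.
have uk : u * k = - v by rewrite /k mulrA uu mulN1r.
have ku : k * u = v by rewrite /k -mulrA -[v * u]opprK -uv mulrN uk opprK.
have vu : v * u = - k by rewrite /k uv opprK.
have vk : v * k = u by rewrite /k mulrA vu mulNr /k -mulrA vv mulrN1 opprK.
have kv : k * v = - u by rewrite /k -mulrA vv mulrN1.
have kk : k * k = -1 by rewrite {2}/k mulrA ku vv.
have e4 (p q r w : int) : Qz (p, q, r, w) = 1 *~ p + u *~ q + v *~ r + k *~ w.
  by rewrite /Qz !mulrzl.
rewrite !e4 !mulrDl !mulrDr !mulrzAl !mulrzAr -!mulrzA uu vv uk ku vu vk kv kk -/k.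
rewrite !mulr1 !mul1r !mulNrz !(mulrzDr, mulrzBr) !addrA.
(* Groups the sixteen products by basis element, four each for 1, [u], [v] and [k]. *)
rewrite [RHS](ACl (1*6*11*16*2*5*12*15*3*8*9*14*4*7*10*13)) /=.
by rewrite !(mulrC a') !(mulrC b') !(mulrC c') !(mulrC d') !mulrNz.
Qed.

Lemma two_neq0 : (2%:R : D) != 0.
Proof.
apply/eqP => e; apply: nc; rewrite /GRing.comm uv; apply/eqP.
by rewrite eq_sym -addr_eq0 -mulr2n -mulr_natl e mul0r.
Qed.

Lemma Qz_conj s : Qz s * Qz (conjq s) = (normq s)%:~R.
Proof. by rewrite -QzM mulq_conj Qzint. Qed.

(** For q = 1 + x u + y v, q - u q u is 2 + 2 x u; the same operation with [v] then leaves 4, which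
    is nonzero because 2 is. *)
Lemma Qz_linear_neq0 (x y : int) : Qz (1, x, y, 0) != 0.
Proof.
apply/eqP => e; have two := two_neq0.
have e2 : Qz (2, 2 * x, 0, 0) = 0.
  have -> : (2, 2 * x, 0, 0) = subq (1, x, y, 0) (mulq (mulq (0, 1, 0, 0) (1, x, y, 0)) (0, 1, 0, 0)) :> quat.
    by rewrite /=; congr (_, _, _, _); ring.
  by rewrite QzB !QzM e mulr0 mul0r subr0.
have: Qz (4, 0, 0, 0) = 0.
  have -> : (4, 0, 0, 0) = subq (2, 2 * x, 0, 0) (mulq (mulq (0, 0, 1, 0) (2, 2 * x, 0, 0)) (0, 0, 1, 0)) :> quat.
    by rewrite /=; congr (_, _, _, _); ring.
  by rewrite QzB !QzM e2 mulr0 mul0r subr0.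
rewrite Qzint; apply/eqP; rewrite -[4%:~R]/(2 * 2)%:R natrM.
exact: mulf_neq0_div.
Qed.

(** The characteristic is 0. In odd characteristic p, choosing a^2 + b^2 + 1 = 0 mod p would make
    the norm of 1 + a u + b v vanish, although this element and its conjugate are nonzero. *)
Lemma natr_neq0_Q8 n : (0 < n)%N -> (n%:R : D) != 0.
Proof.
elim/ltn_ind: n => n ih n0; have [n1|n1] := leqP n 1.
  by have -> : n = 1%N by [apply/eqP; rewrite eqn_leq n1 n0]; apply: oner_neq0.
have pp := pdiv_prime n1; rewrite -(divnK (pdiv_dvd n)) natrM.
apply: mulf_neq0_div => //.
  by apply: ih; [apply: ltn_Pdiv => //; apply: prime_gt1|rewrite divn_gt0 ?pdiv_gt0 // pdiv_leq].
have [->|op] := even_prime pp; first exact: two_neq0.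
set p := pdiv n in pp op *; have [a [b e]] := sum_sqr_Fp pp op.
pose s : quat := (1, (val a)%:Z, (val b)%:Z, 0).
have /dvdnP [k hk] : (p %| val a * val a + val b * val b + 1)%N.
  by rewrite (dvdn_pcharf (pchar_Fp pp)) !natrD !natrM !natr_Zp -!expr2 e.
have : (normq s)%:~R != 0 :> D.
  rewrite -Qz_conj; apply: mulf_neq0_div => //; first exact: Qz_linear_neq0.
  have -> : conjq s = (1, - (val a)%:Z, - (val b)%:Z, 0) by [].
  exact: Qz_linear_neq0.
have -> : normq s = (k * p)%N%:Z.
  by rewrite -hk /s /= !PoszD !PoszM; ring.
by apply: contraNneq => p0; rewrite -pmulrn natrM p0 mulr0.
Qed.

Lemma intr_neq0_Q8 (n : int) : n != 0 -> (n%:~R : D) != 0.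
Proof.
case: n => n n0; first by rewrite -pmulrn natr_neq0_Q8 // lt0n.
by rewrite NegzE mulrNz oppr_eq0 natr_neq0_Q8.
Qed.

Lemma Qz_neq0 s : normq s != 0 -> Qz s != 0.
Proof.
by move/intr_neq0_Q8; apply: contraNneq => e; rewrite -Qz_conj e mul0r.
Qed.

Lemma Qz_comm s t : mulq s t = mulq t s -> GRing.comm (Qz s) (Qz t).
Proof. by rewrite /GRing.comm -!QzM => ->. Qed.

Lemma in_Q8_units w : in_Q8 u v w -> exists2 s, s \in units8 & w = Qz s.
Proof.
have QzN (a b c d : int) : Qz (- a, - b, - c, - d) = - Qz (a, b, c, d).
  by rewrite /= !mulrNz !mulNr -!opprD.
have Qzk : Qz (0, 0, 0, 1) = u * v.
  by rewrite /= !mulr0z !mul0r mulr1z mul1r !add0r.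
case=> -[] ->.
- by exists (0, 1, 0, 0) => //; rewrite Qzu.
- by exists (0, -1, 0, 0) => //; rewrite -Qzu -QzN oppr0.
- by exists (0, 0, 1, 0) => //; rewrite Qzv.
- by exists (0, 0, -1, 0) => //; rewrite -Qzv -QzN oppr0.
- by exists (0, 0, 0, 1) => //; rewrite Qzk.
- by exists (0, 0, 0, -1) => //; rewrite -Qzk -QzN oppr0.
Qed.

(** 3 + 4 i has norm 25, a square, so it will belong to the subgroup built around [M]; yet it
    rotates j to a quaternion that is not a unit of the list. *)
Lemma cj_Q8_3_4 : ~ in_Q8 u v (cj (Qz (3, 4, 0, 0)) v).
Proof.
case/in_Q8_units => s hs e.
have g0 : Qz (3, 4, 0, 0) != 0 by apply: Qz_neq0.
have {}e : Qz (mulq (3, 4, 0, 0) s) = Qz (mulq (0, 0, 1, 0) (3, 4, 0, 0)).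
  by rewrite !QzM Qzv -e cjE.
have: normq (subq (mulq (3, 4, 0, 0) s) (mulq (0, 0, 1, 0) (3, 4, 0, 0))) != 0.
  have: all (fun s => normq (subq (mulq (3, 4, 0, 0) s) (mulq (0, 0, 1, 0) (3, 4, 0, 0))) != 0) units8.
    by vm_compute.
  by move/allP; apply.
by move/Qz_neq0; rewrite QzB e subrr eqxx.
Qed.

Lemma Q8_in_divring E : is_division_subring E -> E u -> E v ->
  ~ (forall g w, E g -> g != 0 -> in_Q8 u v w -> in_Q8 u v (cj g w)).
Proof.
move=> hE Eu Ev h; apply: cj_Q8_3_4; apply: h; last by constructor 2; left.
  rewrite /= !mulr0z !mul0r !addr0; apply: (dsrD hE); first exact: (dsr_nat hE 3).
  by apply: (dsrM hE) => //; apply: (dsr_nat hE 4).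
exact: Qz_neq0.
Qed.

(** [m] acts on the quaternion group like some [e] in [units24], so [m * (Qz e)^-1] centralises [u]
    and [v]. *)
Lemma Q8_normaliser m : m != 0 -> in_Q8 u v (cj m u) -> in_Q8 u v (cj m v) ->
  exists e z, [/\ normq e \in [:: 1; 2; 4], z != 0, GRing.comm z u, GRing.comm z v & m = z * Qz e].
Proof.
move=> m0 /in_Q8_units [s s8 es] /in_Q8_units [t t8 et].
have /allP /(_ _ s8) /allP /(_ _ t8) /orP [/eqP st|] := units24P.
  case: nc; have := Qz_comm st; rewrite -es -et.
  by move/(cj_commute hD (invr_neq0_div m0)); rewrite !cjK.
case/hasP=> e _ /and3P [/eqP eu /eqP ev ne]; exists e, (m * (Qz e)^-1).
have e0 : Qz e != 0 by apply: Qz_neq0; move: ne; rewrite !inE => /or3P [] /eqP ->.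
have Ue := hD e0.
split=> //; last by rewrite mulrVK.
- by rewrite mulf_neq0_div ?invr_neq0_div.
- have h : u * Qz e = Qz e * cj m u by rewrite es -QzM -eu QzM Qzu.
  rewrite /GRing.comm mulrA -(cjE hD m0) -[LHS]mulrA -[RHS]mulrA; congr (_ * _).
  by apply: (mulrI Ue); rewrite mulVKr // mulrA -h mulrK.
- have h : v * Qz e = Qz e * cj m v by rewrite et -QzM -ev QzM Qzv.
  rewrite /GRing.comm mulrA -(cjE hD m0) -[LHS]mulrA -[RHS]mulrA; congr (_ * _).
  by apply: (mulrI Ue); rewrite mulVKr // mulrA -h mulrK.
Qed.

(** The additive commutators of [s] with i and j have norms 4 (c^2 + d^2) and 4 (b^2 + d^2). *)
Lemma Qz_central s : GRing.comm (Qz s) u -> GRing.comm (Qz s) v ->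
  exists a : int, s = (a, 0, 0, 0).
Proof.
case: s => [[[a b] c] d]; set q := (a, b, c, d) => h1 h2.
have {}h1 : Qz (mulq q (0, 1, 0, 0)) = Qz (mulq (0, 1, 0, 0) q) by rewrite !QzM Qzu.
have {}h2 : Qz (mulq q (0, 0, 1, 0)) = Qz (mulq (0, 0, 1, 0) q) by rewrite !QzM Qzv.
have N0 (s t : quat) : Qz s = Qz t -> normq (subq s t) = 0.
  move=> e; apply/eqP; apply: contraT => /Qz_neq0.
  by rewrite QzB e subrr eqxx.
move/N0: h1; move/N0: h2 => /= h2 h1.
have sq (x y : int) : 4 * (x * x + y * y) = 0 -> x = 0 /\ y = 0.
  move/eqP; rewrite mulf_eq0 /= paddr_eq0 -?expr2 ?sqr_ge0 // !sqrf_eq0.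
  by case/andP => /eqP -> /eqP ->.
have [d0 c0] : d = 0 /\ c = 0 by apply: sq; rewrite -[RHS]h1; ring.
have [b0 _] : b = 0 /\ d = 0 by apply: sq; rewrite -[RHS]h2; ring.
by exists a; rewrite /q b0 c0 d0.
Qed.

End Quaternions.


(** * Theorems of Cartan-Brauer-Hua type and maximal subgroups *)

Section Hua.

Context (D : unitRingType) (hD : is_division_ring D).
Implicit Types (a b c g h m w x y z : D) (A B E G H K M P T : D -> Prop).

Definition star E x := E x /\ x != 0.

(* Comparing conjugation by [x] and by [1 + x] solves for [x]. *)
Lemma cartan_brauer_hua_step x a : x != 0 -> 1 + x != 0 ->
  GRing.comm a x \/ x = (a - cj (1 + x) a) * (cj (1 + x) a - cj x a)^-1.
Proof.
move=> x0 y0; set b1 := cj (1 + x) a; set b0 := cj x a.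
have e0 : x * b0 = a * x by rewrite cjE.
have e : x * (b1 - b0) = a - b1.
  have := cjE hD y0 a; rewrite -/b1 mulrDl mulrDr mul1r mulr1 -e0 => h.
  by apply: (addrI b1); rewrite mulrBr addrA h addrK addrC subrK.
have [d0|d0] := eqVneq (b1 - b0) 0; last by right; rewrite -e mulrK // hD.
left; apply: (cj_fix hD x0); move: e; rewrite d0 mulr0 => /esym/eqP.
by move/eqP: d0; rewrite -/b0 !subr_eq0 => /eqP <- /eqP.
Qed.

(** [a] commutes with its conjugates under [E], and the previous step writes [x] in terms of
    them. *)
Lemma cartan_brauer_hua_abelian E A : is_division_subring E -> (forall x, A x -> E x) ->
  abelian_set A -> (forall g x, star E g -> A x -> A (cj g x)) ->
  forall x a, E x -> A a -> GRing.comm a x.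
Proof.
move=> hE AE abA iA x a Ex Aa.
have [->|x0] := eqVneq x 0; first exact: commr0.
have [y0|y0] := eqVneq (1 + x) 0.
  by move/eqP: y0; rewrite addrC addr_eq0 => /eqP ->; apply: commrN1.
have [//|->] := cartan_brauer_hua_step a x0 y0.
have c0 : A (cj x a) by apply: iA.
have c1 : A (cj (1 + x) a) by apply: iA => //; split=> //; apply: (dsrD hE) => //; apply: dsr1.
by apply: commrM; [|apply: commrV]; apply: commrB; apply: abA.
Qed.

Lemma cartan_brauer_hua K : is_division_subring K ->
  (forall g x, g != 0 -> K x -> K (cj g x)) -> (forall x, K x -> center x) \/ forall x, K x.
Proof.
move=> hK iK; apply: NNPP => H; apply: (H); left.
have [y ny] : exists y, ~ K y.
  apply: NNPP => H'; apply: H; right=> x; apply: NNPP => nx; apply: H'; by exists x.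
(* Solving for an [x] outside [K] would put it in [K]. An [x] in [K] is (x + y) - y, with both terms
   outside. *)
have out x a : ~ K x -> K a -> GRing.comm a x.
  move=> nx Ka; have x0 : x != 0 by apply/eqP => x0; apply: nx; rewrite x0; apply: dsr0.
  have y0 : 1 + x != 0.
    apply/eqP => /eqP; rewrite addrC addr_eq0 => /eqP e; apply: nx.
    by rewrite e; apply: (dsrN hK); apply: dsr1.
  have [//|e] := cartan_brauer_hua_step a x0 y0; case: nx; rewrite e.
  apply: (dsrM hK); first by apply: (dsrB hK) => //; apply: iK.
  by apply: (dsrV hK); apply: (dsrB hK); apply: iK.
move=> a Ka x; have [Kx|nx] := classic (K x); last exact: out.
have nxy : ~ K (x + y) by move=> h; apply: ny; rewrite -(addKr x y) addrC; apply: (dsrB hK).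
by have := commrB (out _ _ nxy Ka) (out _ _ ny Ka); rewrite addrK.
Qed.

(** Comparing conjugation by [m] on [y] and on [1 + y] gives y (c - d) = d - 1, which expresses [y]
    through elements commuting with [m]. *)
Lemma comm_of_commutators m y : m != 0 -> y != 0 -> 1 + y != 0 ->
  GRing.comm m (commutator y m) -> GRing.comm m (commutator (1 + y) m) -> GRing.comm y m.
Proof.
move=> m0 y0 z0; set c := commutator y m; set d := commutator (1 + y) m => mc md.
have ec : cj m y = y * c by rewrite (cj_commutator hD).
have : cj m (1 + y) = (1 + y) * d by rewrite (cj_commutator hD).
rewrite cjD cj1 // ec mulrDl mul1r => h.
have {}h : y * (c - d) = d - 1.
  by apply: (addrI 1); rewrite mulrBr addrA h addrK addrC subrK.
have [cd|cd] := eqVneq (c - d) 0.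
  have d1 : d = 1 by apply/eqP; rewrite -subr_eq0 -h cd mulr0.
  by apply: (cj_fix hD m0); move/eqP: cd; rewrite subr_eq0 ec d1 => /eqP ->; rewrite mulr1.
have -> : y = (d - 1) * (c - d)^-1 by rewrite -h mulrK // hD.
apply: commr_sym; apply: commrM; first exact/commrB/commr1.
exact/commrV/commrB.
Qed.

Lemma class2_div_commutative E : is_division_subring E ->
  (forall x y z, star E x -> star E y -> E z -> GRing.comm z (commutator x y)) -> abelian_set E.
Proof.
move=> hE hc y m Ey Em.
have [->|m0] := eqVneq m 0; first exact: commr0.
have [->|y0] := eqVneq y 0; first exact/commr_sym/commr0.
have [z0|z0] := eqVneq (1 + y) 0.
  by move/eqP: z0; rewrite addrC addr_eq0 => /eqP ->; apply/commr_sym/commrN1.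
have E1y : E (1 + y) by apply: (dsrD hE) => //; apply: dsr1.
by apply: comm_of_commutators => //; apply: hc.
Qed.

Section Star.
Context (E : D -> Prop) (hE : is_division_subring E).
Let hS : is_subgroup (star E) := dsr_subgroup hD hE.
Let hd : is_subgroup (derived (star E)) := derived_subgroup hD hS.

Lemma star_derived_inv : inv_under (star E) (derived (star E)).
Proof. by apply: derived_inv => // g x; apply: sg_cj. Qed.

Lemma hua_metabelian : abelian_set (derived (star E)) -> abelian_set E.
Proof.
move=> ab; apply: class2_div_commutative => // x y z Ex Ey Ez; apply: commr_sym.
apply: (cartan_brauer_hua_abelian hE _ ab) => //; last exact: derived_comm.
- by move=> w /(derived_sub hS) [].
- exact: star_derived_inv.
Qed.

Lemma hua_locally_solvable : locally_solvable (star E) -> algebraic_set (derived (star E)) ->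
  abelian_set E.
Proof.
move=> ls alg; have dS := derived_sub hS.
have lsd : locally_solvable (derived (star E)) by move=> s hs; apply: ls => x /hs/dS.
have [A hA AG abA iA a Aa x [Ex x0]||[u [v [[du dv] uu vv [uv nc] iQ]]]] :=
  solvable_normal_dichotomy hD hS hd dS star_derived_inv alg lsd.
- have AE y : A y -> E y by move=> /AG/dS [].
  exact: (cartan_brauer_hua_abelian hE AE abA iA Ex Aa).
- move=> h; apply: class2_div_commutative => // x y z Sx Sy Ez; apply: commr_sym.
  have [->|z0] := eqVneq z 0; first exact: commr0.
  by apply: h; [apply: derived_comm|split].
case: (Q8_in_divring hD uu vv uv nc hE (proj1 (dS _ du)) (proj1 (dS _ dv))).
by move=> g w Eg g0; apply: iQ.
Qed.

End Star.

Section Maximal.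
Context (M : D -> Prop) (hnc : exists x y : D, x * y != y * x)
  (hM : maximal_subgroup M) (hirr : irreducible_subgroup M).

Let sM : is_subgroup M. Proof. by case: hM. Qed.

Lemma cent_center x : cent M x -> center x.
Proof.
move=> hx y; have hC := cent_divsubring (eq x).
suff : cent (eq x) y by move=> /(_ x erefl)/commr_sym.
by apply: (hirr y hC) => [z hz _ <-|z Mz _ <-]; [apply: hz|apply/commr_sym/hx].
Qed.

Lemma M_not_central : ~ (forall x, M x -> center x).
Proof.
move=> h; have [x [y /eqP]] := hnc; apply; apply: cent_center => z Mz.
by apply/commr_sym/h.
Qed.

(* Maximality applied to the product of [M] with the units of [E]. *)
Lemma normalised_divsubring E : is_division_subring E -> inv_under M E ->
  [\/ forall x, star E x -> M x, forall x, E x -> center x | forall x, E x].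
Proof.
move=> hE iE; have hS := dsr_subgroup hD hE.
have iS : inv_under M (star E).
  move=> m x Mm [Ex x0]; split; first exact: iE.
  by apply: cj_neq0 => //; apply: (sg_neq0 sM).
pose P x := exists m e, [/\ M m, star E e & x = m * e].
have hP : is_subgroup P.
  split.
  - by exists 1, 1; split; [apply: sg1|apply: (sg1 hS)|rewrite mulr1].
  - by move=> _ [m [e [Mm [_ e0] ->]]]; apply: mulf_neq0_div => //; apply: (sg_neq0 sM).
  - move=> _ _ [m [e [Mm Se ->]]] [m' [e' [Mm' Se' ->]]].
    exists (m * m'), (cj m' e * e'); split; first exact: sgM.
      by apply: (sgM hS) => //; apply: iS.
    by rewrite -(mulrA m m') (mulrA m' (cj m' e)) cjE ?(sg_neq0 sM) // -(mulrA m e) (mulrA e).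
  - move=> _ [m [e [Mm Se ->]]]; have Mm' := sgV sM Mm.
    exists m^-1, (cj m^-1 e^-1); split=> //; first by apply: iS => //; apply: (sgV hS).
    rewrite (cjE hD (sg_neq0 sM Mm')) invrM //; first exact: (hD (sg_neq0 sM Mm)).
    exact: (hD (sg_neq0 hS Se)).
have [prop|nprop] := classic (exists x, x != 0 /\ ~ P x).
  constructor 1 => x Sx; case: hM => _ _ /(_ P hP); apply=> //.
    by move=> m Mm; exists m, 1; split=> //; [apply: (sg1 hS)|rewrite mulr1].
  by exists 1, x; split; [apply: sg1| |rewrite mul1r].
have allP x : x != 0 -> P x.
  by move=> x0; apply: NNPP => h; apply: nprop; exists x.
have iA g x : g != 0 -> E x -> E (cj g x).
  move=> /allP [m [e [Mm [Ee e0] ->]]] Ex; rewrite (cjMg hD (sg_neq0 sM Mm) x e0).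
  by apply: (dsrM hE) => //; apply: (dsrM hE); [apply: (dsrV hE)|apply: iE].
have [h|h] := cartan_brauer_hua hE iA; [exact: Or32|exact: Or33].
Qed.

(** Otherwise the centraliser of a noncentral [x] in [M] is normalised by [M], so its units, among
    them [1 + x], lie in [M]; then [comm_of_commutators] makes [x] commute with all of [M]. *)
Lemma derived_not_central : ~ (forall x, derived M x -> center x).
Proof.
move=> h; apply: M_not_central => x Mx; apply: NNPP => nx; apply: (nx).
have hC := cent_divsubring (eq x).
have xC : cent (eq x) x by move=> _ <-.
have iC : inv_under M (cent (eq x)).
  move=> m y Mm hy _ <-; have m0 := sg_neq0 sM Mm.
  have yx : GRing.comm y x by apply: hy.
  move: (cj_commute hD m0 yx); rewrite [cj m x](cj_commutator hD) ?(sg_neq0 sM) //.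
  have := h _ (derived_comm Mx Mm); have := sg_neq0 sM (sg_comm sM Mx Mm).
  move: (commutator x m) (cj m y) => c w c0 cc e; apply: (mulIr_div hD c0).
  by rewrite -mulrA e -!mulrA cc.
have x0 : x != 0 by apply: (sg_neq0 sM).
have [CM|Cc|Cd] := normalised_divsubring hC iC; last first.
- by move=> y; apply/commr_sym; apply: Cd.
- exact: Cc.
have x1 : 1 + x != 0.
  apply/eqP => /eqP; rewrite addrC addr_eq0 => /eqP e; apply: nx => y.
  by rewrite e mulN1r mulrN1.
have M1x : M (1 + x).
  by apply: CM; split=> // _ <-; apply/commr_sym/commrD => //; apply: commr1.
apply: cent_center => m Mm; apply: comm_of_commutators => //; first exact: (sg_neq0 sM).
  by apply: esym; apply: h; apply: derived_comm.
by apply: esym; apply: h; apply: derived_comm.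
Qed.

End Maximal.

End Hua.


(** * No quaternion group is normal in M *)

Lemma odd_valuation_not_square (p k : nat) (m s : int) : prime p -> odd (logn p k) -> (0 < k)%N ->
  m != 0 -> k%:Z * (m * m) <> s * s.
Proof.
move=> pp ok k0 m0 /(congr1 absz); rewrite !abszM absz_nat => e.
have m0' : (0 < `|m|)%N by rewrite absz_gt0.
have s0 : (0 < `|s|)%N.
  have : (0 < k * (`|m| * `|m|))%N by rewrite !muln_gt0 k0 m0'.
  by rewrite e muln_gt0 andbb.
have := congr1 (logn p) e; rewrite !lognM ?muln_gt0 ?m0' // => h.
by move: ok; have := congr1 odd h; rewrite !oddD !addbb addbF => ->.
Qed.

Section NoQ8.

Context (D : unitRingType) (hD : is_division_ring D) (M : D -> Prop)
  (hM : maximal_subgroup M) (hirr : irreducible_subgroup M).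
Let sM : is_subgroup M. Proof. by case: hM. Qed.

Lemma Q8_not_normal (u v : D) : u * u = -1 -> v * v = -1 -> u * v = - (v * u) ->
  ~ GRing.comm u v -> ~ (forall x w, M x -> in_Q8 u v w -> in_Q8 u v (cj x w)).
Proof.
move=> uu vv uv nc hQ; pose S := in_Q8 u v.
have Su : S u by constructor 1; left.
have Sv : S v by constructor 2; left.
have cS z : GRing.comm z u -> GRing.comm z v -> cent S z.
  move=> zu zv w hw; apply: commr_sym.
  by case: hw => h; apply: (pm_comm h); apply: commr_sym => //; apply: commrM.
have iC : inv_under M (cent S) by move=> m z Mm hz; apply: (cent_inv hD sM hQ).
have iE : inv_under M (cent (cent S)) by move=> m z Mm hz; apply: (cent_inv hD sM iC).
have hE := cent_divsubring (cent S).
have Eu : cent (cent S) u by move=> z /(_ u Su)/commr_sym.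
have Ev : cent (cent S) v by move=> z /(_ v Sv)/commr_sym.
(* The double centraliser contains [u] and [v], so it is not central; its units are not all in [M],
   since 3 + 4 u does not normalise [S]. Hence it is [D]. *)
have central z : cent S z -> center z.
  have [EM|Ec|ED] := normalised_divsubring hD hM hE iE.
  - case: (Q8_in_divring hD uu vv uv nc hE Eu Ev) => g w Eg g0 hw.
    by apply: hQ => //; apply: EM.
  - by case: nc; apply: Ec.
  - by move=> hz y; apply: commr_sym; apply: ED.
pose Q := Qz u v.
(* The scalar multiples of integer quaternions of norm [m^2] or [2 m^2] form a proper subgroup:
   [2 + i], of norm 5, is not among them. It contains [M] but also [3 + 4 i], which does not normalise. *)
pose P x := exists (f : D) t (m : int), [/\ center f /\ f != 0, m != 0,
  normq t = m * m \/ normq t = 2 * (m * m) & x = f * Q t].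
have normP t (m : int) : m != 0 -> normq t = m * m \/ normq t = 2 * (m * m) -> Q t != 0.
  move=> m0 h; apply: (Qz_neq0 hD uu vv uv nc).
  by case: h => ->; rewrite !mulf_eq0 ?orbb.
have hZ := center_divsubring D.
have hP : is_subgroup P.
  split.
  - exists 1, (1, 0, 0, 0), 1; split=> //; last by rewrite /Q Qz1 mulr1.
      by split; [apply: (dsr1 hZ)|apply: oner_neq0].
    by left.
  - by move=> _ [f [t [m [[_ f0] m0 h ->]]]]; apply: mulf_neq0_div => //; apply: normP h.
  - move=> _ _ [f [t [m [[fc f0] m0 h ->]]]] [g [s [n [[gc g0] n0 h' ->]]]].
    have em : f * g * Q (mulq t s) = f * Q t * (g * Q s).
      by rewrite /Q (QzM uu vv uv) -!mulrA [Q t * (g * _)]mulrA -(gc (Q t)) -!mulrA.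
    have fgc : center (f * g) /\ f * g != 0.
      by split; [apply: (dsrM hZ)|apply: mulf_neq0_div].
    case: h => h; case: h' => h'.
    + exists (f * g), (mulq t s), (m * n); split=> //; first by rewrite mulf_neq0.
      by left; rewrite normqM h h'; ring.
    + exists (f * g), (mulq t s), (m * n); split=> //; first by rewrite mulf_neq0.
      by right; rewrite normqM h h'; ring.
    + exists (f * g), (mulq t s), (m * n); split=> //; first by rewrite mulf_neq0.
      by right; rewrite normqM h h'; ring.
    + exists (f * g), (mulq t s), (2 * (m * n)); split=> //; first by rewrite !mulf_neq0.
      by left; rewrite normqM h h'; ring.
  - move=> _ [f [t [m [[fc f0] m0 h ->]]]].
    have n0 : (normq t)%:~R != 0 :> D.
      by apply: (intr_neq0_Q8 hD uu vv uv nc); case: h => ->; rewrite !mulf_eq0 ?orbb.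
    have nz : center ((normq t)%:~R : D) by move=> y; rewrite mulrzl mulrzr.
    exists (f^-1 * ((normq t)%:~R)^-1), (conjq t), m; split=> //.
    + split; first by apply: (dsrM hZ); apply: (dsrV hZ).
      by rewrite mulf_neq0_div ?invr_neq0_div.
    + by rewrite normq_conj.
    have t0 := normP _ _ m0 h; apply: (mulrI_div hD (mulf_neq0_div hD f0 t0)).
    rewrite mulrV ?hD ?mulf_neq0_div //.
    have c : center (f^-1 * ((normq t)%:~R)^-1 : D) by apply: (dsrM hZ); apply: (dsrV hZ).
    rewrite (mulrA (f * Q t)) -(c (f * Q t)) -mulrA -(mulrA f) (Qz_conj uu vv uv).
    by rewrite -(nz f) -mulrA mulKr ?mulVr ?hD.
have MP m : M m -> P m.
  move=> Mm; have m0 := sg_neq0 sM Mm.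
  have [e [z [ne z0 zu zv em]]] := Q8_normaliser hD uu vv uv nc m0 (hQ _ _ Mm Su) (hQ _ _ Mm Sv).
  have zc := central _ (cS _ zu zv).
  move: ne; rewrite !inE => /or3P [] /eqP ne.
  - by exists z, e, 1; split=> //; left.
  - by exists z, e, 1; split=> //; right.
  - by exists z, e, 2; split=> //; left.
have nP : exists x, x != 0 /\ ~ P x.
  exists (Q (2, 1, 0, 0)); split; first exact: (Qz_neq0 hD uu vv uv nc).
  case=> f [t [m [[fc f0] m0 h e]]].
  (* If 2 + u = f t, then f t (2 - u) = 5, so t (2 - u) is central and thus an integer [s]. Norms
     give s^2 = 5 m^2 or 10 m^2, with an odd exponent of 5. *)
  have [s hs] : exists s : int, mulq t (2, -1, 0, 0) = (s, 0, 0, 0).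
    have e5 : f * Q (mulq t (2, -1, 0, 0)) = 5%:R.
      by rewrite /Q (QzM uu vv uv) mulrA -/(Q t) -e -(QzM uu vv uv) -[5%:R]/(5%:~R) -(Qzint u v).
    have c : center (Q (mulq t (2, -1, 0, 0))).
      have -> : Q (mulq t (2, -1, 0, 0)) = f^-1 * 5%:R by rewrite -e5 mulKr ?hD.
      by apply: (dsrM hZ); [apply: (dsrV hZ)|apply: (dsr_nat hZ)].
    by apply: (Qz_central hD uu vv uv nc); apply: c.
  have := congr1 normq hs; rewrite normqM /=.
  case: h => -> e2.
    by apply: (@odd_valuation_not_square 5 5 m s); rewrite //; move: e2; lia.
  by apply: (@odd_valuation_not_square 5 10 m s); rewrite //; move: e2; lia.
have PM : forall x, P x -> M x by case: hM => _ _; apply.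
apply: (cj_Q8_3_4 hD uu vv uv nc); apply: hQ => //; apply: PM.
exists 1, (3, 4, 0, 0), 5; split=> //; last by rewrite mul1r.
  by split; [apply: (dsr1 hZ)|apply: oner_neq0].
by left.
Qed.

End NoQ8.


(** * Self-centralising subfields normalised by M *)

Section SelfCentralising.

Context (D : unitRingType) (hD : is_division_ring D).
Implicit Types (a b c g h m x y z : D) (A B E G H K L M N P T : D -> Prop).

Local Notation der n := (iter n (@derived D)).

Lemma finite_orbit M a : is_subgroup M -> algebraic_over_center a ->
  (forall g h, M g -> M h -> GRing.comm (cj g a) (cj h a)) ->
  exists o : seq D, forall y, y \in o <-> exists2 m, M m & y = cj m a.
Proof.
move=> sM alga comO; apply: NNPP => H.
have [n hn] := conj_repeat hD alga.
have [s [us sz hs]] : exists s : seq D, [/\ uniq s, size s = n & forall y, y \in s -> exists2 m, M m & y = cj m a].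
  elim: {hn} n => [|k [s [us sz hs]]]; first by exists [::].
  have [y [[m Mm ey] ys]] : exists y, (exists2 m, M m & y = cj m a) /\ y \notin s.
    apply: NNPP => H'; apply: H; exists s => y; split; first exact: hs.
    move=> hy; apply: NNPP => /negP ys; apply: H'; by exists y.
  exists (y :: s); split=> [|/=|z]; first by rewrite /= ys us.
    by rewrite sz.
  by rewrite inE => /orP [/eqP ->|/hs //]; exists m.
(* The default value [a] keeps out-of-range entries inside the orbit. *)
have orb i : exists2 m, M m & nth a s i = cj m a.
  have [si|si] := ltnP i (size s); first by apply/hs/mem_nth.
  by exists 1; [apply: sg1|rewrite nth_default // cj1g].
have hy i : exists2 g, g != 0 & nth a s i = cj g a.
  by have [m Mm e] := orb i; exists m => //; apply: (sg_neq0 sM).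
have cy i j : GRing.comm (nth a s i) (nth a s j).
  by have [[g Mg ->] [h Mh ->]] := (orb i, orb j); apply: comO.
have [i [j [ij jn /eqP e]]] := hn _ hy cy.
by move: e; rewrite nth_uniq ?sz ?(ltn_trans ij) // ltn_eqF.
Qed.

(** A nonzero constant term lets the relation be solved for the inverse; a zero one lets [y] be
    cancelled, which shortens the relation. *)
Lemma inv_of_dependence K L n y (c : 'I_n -> D) : is_division_subring L ->
  (forall x, L x -> K x) -> (forall x z, K x -> K z -> K (x + z)) ->
  (forall x z, K x -> K z -> K (x * z)) -> K y -> y != 0 ->
  (forall i, L (c i)) -> (exists i, c i != 0) -> \sum_i c i * y ^+ i = 0 -> K y^-1.
Proof.
move=> hL LK KD KM Ky y0.
elim: n c => [c _ [[]] //|n ih c hc [i ci]].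
rewrite big_ord_recl expr0 mulr1.
pose S := \sum_(j < n) c (lift ord0 j) * y ^+ j.
have -> : \sum_(j < n) c (lift ord0 j) * y ^+ lift ord0 j = S * y.
  by rewrite mulr_suml; apply: eq_bigr => j _; rewrite -mulrA -exprSr.
move=> e; have [c0|c0] := eqVneq (c ord0) 0.
  apply: (ih (fun j => c (lift ord0 j))) => //.
    by case: (unliftP ord0 i) ci => [j|] ->; [exists j|rewrite c0 eqxx].
  by move: e; rewrite c0 add0r => /(mulf_eq0_div hD) [] // /eqP; rewrite (negbTE y0).
have K0 : K 0 by apply: LK; apply: dsr0.
have KS : K S.
  apply: (big_ind K) => // j _; apply: (KM) => //; first exact: LK.
  elim: (nat_of_ord j) => [|k ihk]; first by apply: LK; apply: dsr1.
  by rewrite exprS; apply: KM.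
have -> : y^-1 = - (c ord0)^-1 * S.
  apply: (mulIr_div hD y0); rewrite mulVr ?hD // -mulrA.
  move/eqP: e; rewrite addrC addr_eq0 => /eqP ->.
  by rewrite mulrNN mulVr ?hD.
by apply: KM => //; apply: LK; apply: (dsrN hL); apply: (dsrV hL).
Qed.

Section Maximal.
Context (M : D -> Prop) (hnc : exists x y : D, x * y != y * x)
  (hM : maximal_subgroup M) (hirr : irreducible_subgroup M).
Let sM : is_subgroup M. Proof. by case: hM. Qed.

Section Field.
Context (L : D -> Prop) (hL : is_division_subring L) (iL : inv_under M L) (LM : forall x, star L x -> M x)
  (abL : abelian_set L) (cL : forall x, cent L x -> L x).

Let sL : is_subgroup (star L) := dsr_subgroup hD hL.
Let isL : inv_under M (star L).
Proof.
move=> m x Mm [Lx x0]; split; first exact: iL.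
by apply: cj_neq0 => //; apply: (sg_neq0 sM).
Qed.

Definition modL x y := exists2 l, star L l & x = l * y.

Lemma modL_mul x x' y y' : M y -> modL x y -> modL x' y' -> modL (x * x') (y * y').
Proof.
move=> My [l Sl ->] [l' Sl' ->]; have My' := sgV sM My.
exists (l * cj y^-1 l'); first by apply: (sgM sL) => //; apply: isL.
have y0 := sg_neq0 sM My.
by rewrite -(mulrA l y) -(mulrA l (cj _ _)) (mulrA (cj _ _)) -(cjE hD y0) (cjVK hD y0) -(mulrA y l').
Qed.

Lemma modL_inv x y : M y -> modL x y -> modL x^-1 y^-1.
Proof.
move=> My [l Sl ->]; exists (cj y l^-1); first by apply: isL => //; apply: (sgV sL).
by rewrite invrM ?hD ?(sg_neq0 sM My) ?(sg_neq0 sL Sl) // /cj mulrK // hD // (sg_neq0 sM My).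
Qed.

(** The units of [L] are normal in [M], so congruence modulo them respects commutators. *)
Lemma modL_derived X Y : is_subgroup Y -> (forall y, Y y -> M y) ->
  (forall x, X x -> exists2 y, Y y & modL x y) ->
  forall x, derived X x -> exists2 y, derived Y y & modL x y.
Proof.
move=> sY YM XY; have sdY := derived_subgroup hD sY.
have dM y : derived Y y -> M y by move/(derived_sub sY)/YM.
apply: derived_ind.
  split.
  - by exists 1; [apply: (sg1 sdY)|exists 1; [apply: (sg1 sL)|rewrite mulr1]].
  - by move=> _ [y dy [l [_ l0] ->]]; apply: mulf_neq0_div => //; apply: (sg_neq0 sdY).
  - move=> x x' [y dy xy] [y' dy' xy']; exists (y * y'); first exact: (sgM sdY).
    by apply: modL_mul => //; apply: dM.
  - move=> x [y dy xy]; exists y^-1; first exact: (sgV sdY).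
    by apply: modL_inv => //; apply: dM.
move=> x x' /XY [y Yy xy] /XY [y' Yy' xy']; exists (commutator y y').
  exact: derived_comm.
have [My My'] := (YM _ Yy, YM _ Yy'); have [Vy Vy'] := (sgV sM My, sgV sM My').
rewrite /commutator; apply: modL_mul => //; first by do 2?apply: (sgM sM).
by apply: modL_mul => //; [apply: (sgM sM)|apply: modL_mul => //; apply: modL_inv].
Qed.

Lemma modL_der X Y n : is_subgroup Y -> (forall y, Y y -> M y) ->
  (forall x, X x -> exists2 y, Y y & modL x y) ->
  forall x, der n X x -> exists2 y, der n Y y & modL x y.
Proof.
move=> sY YM XY; elim: n => [|n ih] //=.
apply: modL_derived => //; first exact: der_subgroup.
by move=> y /(der_sub hD sY (leq0n n)) /YM.
Qed.

(* A shortest expression of [m] over representatives of cosets of [L] has one term, by Dedekind's argument. *)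
Lemma modL_of_span (I : finType) (r : I -> D) m (f : I -> D) : M m -> (forall i, M (r i)) ->
  (forall i, L (f i)) -> m = \sum_i f i * r i -> exists i, modL m (r i).
Proof.
move=> Mm Mr; have [k] := ubnP #|[set i | f i != 0]|.
have m0 := sg_neq0 sM Mm; have m1 := invr_neq0_div m0.
elim: k f => // k ih f; rewrite ltnS => hk Lf em.
have [i fi] : exists i, f i != 0.
  apply: NNPP => h; move: m0; rewrite em big1 ?eqxx // => i _.
  by have [->|fi] := eqVneq (f i) 0; [rewrite mul0r|case: h; exists i].
have r0 j : r j != 0 by apply: (sg_neq0 sM).
have r1 j : (r j)^-1 != 0 by apply: invr_neq0_div.
pose chi j b := cj (r j)^-1 b.
have Lchi j b : L b -> L (chi j b) by move=> Lb; apply: iL => //; apply: (sgV sM).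
(* If [m] and [r i] act alike on [L], then [m * (r i)^-1] centralises [L] and so lies in it. *)
have [eqc|neqc] := classic (forall b, L b -> cj m^-1 b = chi i b).
  exists i; pose l := m * (r i)^-1.
  have l0 : l != 0 by apply: mulf_neq0_div.
  exists l; last by rewrite mulrVK ?hD.
  split=> //; apply: cL => b Lb; apply: commr_sym; apply: (cj_fix hD l0).
  have Lb' : L (cj m b) by apply: iL.
  by have := eqc _ Lb'; rewrite cjK // cjMg // => {2}->; rewrite /chi.
have [b [Lb nb]] : exists b, L b /\ cj m^-1 b <> chi i b.
  by apply: NNPP => h; apply: neqc => b Lb; apply: NNPP => h'; apply: h; exists b.
set x := cj m^-1 b in nb.
have Lx : L x by apply: iL => //; apply: (sgV sM).
pose de j := x - chi j b.
have Lde j : L (de j) by apply: (dsrB hL) => //; apply: Lchi.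
have di : de i != 0 by rewrite subr_eq0; apply/eqP.
have rel : \sum_j f j * de j * r j = 0.
  transitivity (x * m - m * b).
    rewrite {2}em mulr_suml {1}em mulr_sumr -sumrB; apply: eq_bigr => j _.
    rewrite mulrBr mulrBl (abL (Lf j) Lx) -!mulrA; congr (_ - _ * _).
    by rewrite invrK mulVr ?hD ?mulr1.
  by rewrite /x /cj invrK mulrVK ?hD // subrr.
(* Subtracts the multiple of [rel] that cancels the [i]-th coefficient; the sum remains [m]. *)
pose g j := f j - f j * de j * (de i)^-1.
apply: (ih g).
- apply: leq_trans hk; apply: proper_card; apply/properP; split.
    apply/subsetP => j; rewrite !inE; apply: contra_neq => h.
    by rewrite /g h !mul0r subrr.
  by exists i; rewrite !inE // /g mulrK ?hD // subrr eqxx.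
- by move=> j; apply: (dsrB hL) => //; do 2?apply: (dsrM hL) => //; apply: (dsrV hL).
- transitivity (m - (de i)^-1 * \sum_j f j * de j * r j); first by rewrite rel mulr0 subr0.
  rewrite {1}em mulr_sumr -sumrB; apply: eq_bigr => j _.
  have LV : L (de i)^-1 by apply: (dsrV hL).
  have Lfd : L (f j * de j) by apply: (dsrM hL).
  by rewrite /g mulrBl mulrA (abL LV Lfd).
Qed.
End Field.

End Maximal.
End SelfCentralising.


(** * From an algebraic derived subgroup to a metabelian group *)

Section Forward.

Context (D : unitRingType) (hD : is_division_ring D).
Implicit Types (a b c g h m x y z : D) (A B E G H K L N P T : D -> Prop).
Context (M : D -> Prop) (hnc : exists x y : D, x * y != y * x)
  (hM : maximal_subgroup M) (hirr : irreducible_subgroup M).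
Let sM : is_subgroup M. Proof. by case: hM. Qed.

Local Notation der n := (iter n (@derived D)).

Context (hls : locally_solvable M) (halg : algebraic_set (derived M)).

Lemma hua_in_M E : is_division_subring E -> (forall x, star E x -> M x) -> abelian_set E.
Proof.
move=> hE EM; apply: (hua_locally_solvable hD hE).
  by move=> s hs; apply: hls => x /hs /EM.
by move=> x dx; apply: halg; apply: derived_mono dx.
Qed.

(** Elements of [N] that induce the same map on the finite orbit of [a] differ by an element
    centralising the orbit. Maps not induced by [N] receive the representative 1. *)
Lemma coset_reps L N a : is_subgroup N -> (forall x, N x -> M x) -> algebraic_over_center a ->
  (forall g h, M g -> M h -> GRing.comm (cj g a) (cj h a)) ->
  (forall x, cent (fun y => exists2 m, M m & y = cj m a) x -> L x) ->
  exists (I : finType) (r : I -> D), (forall i, N (r i)) /\ forall x, N x -> exists i, modL L x (r i).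
Proof.
move=> sN NM alga comO cL; have [o ho] := finite_orbit hD sM alga comO.
pose q (i : 'I_(size o)) := nth a o i.
have qo i : q i \in o by apply: mem_nth.
pose acts m (g : {ffun 'I_(size o) -> 'I_(size o)}) := forall i, cj m (q i) = q (g i).
have exr (g : {ffun 'I_(size o) -> 'I_(size o)}) : exists y, N y /\
    ((exists2 x, N x & acts x g) -> acts y g).
  have [[x Nx xg]|h] := classic (exists2 x, N x & acts x g); first by exists x.
  by exists 1; split=> //; apply: (sg1 sN).
have [r hr] := fin_all_exists exr.
exists {ffun 'I_(size o) -> 'I_(size o)}, r; split=> [g|x Nx]; first by case: (hr g).
have exf (i : 'I_(size o)) : exists j : 'I_(size o), cj x (q i) = q j.
  have /ho [m Mm em] := qo i.
  have xo : cj x (q i) \in o.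
    apply/ho; exists (m * x); first by apply: (sgM sM) => //; apply: NM.
    by rewrite cjMg ?(sg_neq0 sM Mm) ?(sg_neq0 sN Nx) // em.
  have h : (index (cj x (q i)) o < size o)%N by rewrite index_mem.
  by exists (Ordinal h); rewrite /q /= nth_index.
have [f hf] := fin_all_exists exf.
have xf : acts x [ffun i => f i] by move=> i; rewrite ffunE.
exists [ffun i => f i]; have [Nr] := hr [ffun i => f i].
move: (r _) Nr => y Ny hy; have {}hy : acts y [ffun i => f i] by apply: hy; exists x.
have [x0 y0] := (sg_neq0 sN Nx, sg_neq0 sN Ny); have y1 := invr_neq0_div y0.
exists (x * y^-1); last by rewrite mulrVK ?hD.
have l0 : x * y^-1 != 0 by apply: mulf_neq0_div.
split=> //; apply: cL => z hz; apply: commr_sym; apply: (cj_fix hD l0).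
have /(nthP a) [k ko <-] : z \in o by apply/ho.
have := xf (Ordinal ko); rewrite -(hy (Ordinal ko)) /q /= => e.
by rewrite cjMg // e cjK.
Qed.

Lemma metabelian_of_normal_orbit a : M a -> algebraic_over_center a -> ~ center a ->
  (forall g h, M g -> M h -> GRing.comm (cj g a) (cj h a)) -> metabelian M.
Proof.
move=> Ma alga na comO; pose O y := exists2 m, M m & y = cj m a; pose L := cent O.
have iO : inv_under M O.
  move=> g _ Mg [m Mm ->]; exists (m * g); first exact: sgM.
  by rewrite cjMg ?(sg_neq0 sM).
have OL y : O y -> L y by move=> [m Mm ->] _ [g Mg ->]; apply: comO.
have Oa : O a by exists 1; [apply: sg1|rewrite cj1g].
have hL : is_division_subring L := cent_divsubring O.
have iL : inv_under M L by move=> m z Mm; apply: (cent_inv hD sM iO).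
have LM : forall x, star L x -> M x.
  have [//|Lc|Lall] := normalised_divsubring hD hM hL iL; case: na.
    exact/Lc/OL.
  by move=> y; apply/commr_sym/Lall.
have abL : abelian_set L by apply: hua_in_M.
have cL x : cent L x -> L x by move=> hx y /OL; apply: hx.
have OL' x : cent O x -> L x by [].
have repsP N (sN : is_subgroup N) (NM : forall x, N x -> M x) :=
  @coset_reps L N a sN NM alga comO OL'.
(* Some derived term inside [L] is assumed here; the coset representatives will supply it at the
   end. *)
have derL k : (forall x, der k M x -> L x) -> metabelian M.
  move=> hk; have [ML|[j [[x [Nx nx]] hj]]] := last_derived hk.
    by move=> x y /(derived_sub sM)/ML hx /(derived_sub sM)/ML; apply: abL.
  set N := der j M in Nx hj.
  have sN : is_subgroup N by apply: der_subgroup.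
  have NM y : N y -> M y by apply: (der_sub hD sM (leq0n j)).
  have iN : inv_under M N by apply: der_inv => // g z; apply: sg_cj.
  have [I [r [Nr hr]]] := repsP N sN NM.
  pose K := lspan L r.
  have KlN l y : L l -> N y -> K (l * y).
    move=> Ll /hr [i [l' [Ll' _] ->]]; rewrite mulrA.
    by apply: lspanZ => //; [apply: (dsrM hL)|apply: lspan_gen].
  have KD y z : K y -> K z -> K (y + z).
    move=> [f hf ->] [g hg ->]; exists (fun i => f i + g i).
      by move=> i; apply: (dsrD hL).
    by rewrite -big_split; apply: eq_bigr => i _; rewrite mulrDl.
  have K0 : K 0 by rewrite -(mul0r 1); apply: KlN; [apply: dsr0 hL|apply: sg1].
  have LK l : L l -> K l by move=> Ll; rewrite -(mulr1 l); apply: KlN => //; apply: sg1.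
  have KM y z : K y -> K z -> K (y * z).
    move=> [f hf ->] [g hg ->]; rewrite mulr_suml; apply: (big_ind K) => // i _.
    rewrite mulr_sumr; apply: (big_ind K) => // j' _.
    have ri0 := sg_neq0 sN (Nr i).
    have -> : f i * r i * (g j' * r j') = f i * cj (r i)^-1 (g j') * (r i * r j').
      rewrite -(mulrA (f i)) -(mulrA (f i) (cj _ _)) (mulrA (cj _ _)) -(cjE hD ri0) (cjVK hD ri0).
      by rewrite -(mulrA (r i) (g j')).
    apply: KlN; last by apply: (sgM sN).
    by apply: (dsrM hL) => //; apply: iL => //; apply: (sgV sM); apply: NM.
  have hK : is_division_subring K.
    split=> //; first by apply: LK; apply: dsr1 hL.
      move=> y z Ky Kz; apply: KD => //; rewrite -mulN1r; apply: KM => //.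
      by apply: LK; apply: (dsrN hL); apply: dsr1 hL.
    (* [K] is finite-dimensional over [L], so the powers of [y] are dependent and
       [inv_of_dependence] applies. *)
    move=> y Ky y0.
    have Kyn n : K (y ^+ n).
      by elim: n => [|n ih]; [apply: LK; apply: dsr1 hL|rewrite exprS; apply: KM].
    have [c [hc c0 e]] := @dependent_fin _ hD L hL I r (fun i => y ^+ i) (fun i => Kyn i).
    exact: (inv_of_dependence hD hL LK KD KM Ky y0 hc c0 e).
  have iK : inv_under M K.
    move=> m y Mm [f hf ->]; have m0 := sg_neq0 sM Mm.
    rewrite cj_sum; apply: (big_ind K) => // i _; rewrite cjM //.
    by apply: KlN; [apply: iL|apply: iN].
  have Kx : K x by rewrite -(mul1r x); apply: KlN => //; apply: dsr1 hL.
  (* [x] does not centralise [L], so [K] is not central, nor commutative as it would be with its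
     units in [M]. *)
  have Kall : forall y, K y.
    have [KMs|Kc|//] := normalised_divsubring hD hM hK iK; case: nx; apply: cL => y Ly.
      by apply: (hua_in_M hK KMs) => //; apply: LK.
    exact: Kc.
  have MN m : M m -> exists2 y, N y & modL L m y.
    move=> Mm; have [f hf em] := Kall m.
    have Mr i : M (r i) by apply: NM.
    have [i hi] := modL_of_span hD hM hL iL abL cL Mm Mr hf em.
    by exists (r i).
  have dL y : derived M y -> L y.
    move=> dy; have [z dz [l [Ll _] ->]] := modL_derived hD hM hL iL sN NM MN dy.
    by apply: (dsrM hL) => //; apply: hj.
  by move=> y z dy dz; apply: abL; apply: dL.
have [I [r [Mr hr]]] := repsP M sM (fun x (h : M x) => h).
(* The finitely many representatives generate a solvable [H], and [M] agrees with [H] modulo the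
   units of [L]. *)
pose s := codom r; pose H := gen_subgroup (fun x => x \in s).
have sM' x : x \in s -> M x by move=> /codomP [i ->].
have sH : is_subgroup H by apply: gen_subgroupP => // x /sM'/(sg_neq0 sM).
have HM x : H x -> M x by apply.
have [k hk] := hls sM'.
apply: (derL k) => x.
have MH y : M y -> exists2 z, H z & modL L y z.
  by move=> /hr [i hi]; exists (r i) => //; apply: sub_gen; apply: codom_f.
case/(modL_der hD hM hL iL sH HM MH) => y /hk -> [l [Ll _] ->].
by rewrite mulr1.
Qed.

Lemma metabelian_of_algebraic_derived : metabelian M.
Proof.
have dM := derived_sub sM; have sdM := derived_subgroup hD sM.
have idM : inv_under M (derived M) by apply: derived_inv => // g x; apply: sg_cj.
have lsd : locally_solvable (derived M) by move=> s hs; apply: hls => x /hs/dM.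
apply: NNPP => nmet.
have [A hA AG abA iA a Aa x Mx|h|] := solvable_normal_dichotomy hD sM sdM dM idM halg lsd.
- apply: NNPP => nax; apply: nmet.
  have Ma : M a by apply: dM; apply: AG.
  have alga : algebraic_over_center a by apply: halg; apply: AG.
  apply: (metabelian_of_normal_orbit Ma alga).
    by move=> ca; apply: nax; apply: ca.
  by move=> g h Mg Mh; apply: abA; apply: iA.
- apply: (derived_not_central hD hnc hM hirr) => x dx.
  by apply: (cent_center hirr); apply: h.
- case=> u [v [_ uu vv [uv nc] iQ]].
  exact: (Q8_not_normal hD hM uu vv uv nc iQ).
Qed.

End Forward.


(** * From a metabelian group to an algebraic derived subgroup *)

Section Backward.

Context (D : unitRingType) (hD : is_division_ring D).
Implicit Types (a b c g h m x y z : D) (A B E G H K L N P T : D -> Prop).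

Definition prodXsub (s : seq D) : {poly D} := \prod_(a <- s) ('X - a%:P).

Lemma coef_prodXsub_cj y s k : y != 0 ->
  cj y (prodXsub s)`_k = (prodXsub (map (cj y) s))`_k.
Proof.
move=> y0; rewrite /prodXsub; elim/last_ind: s k => [|s a ih] k.
  by rewrite !big_nil !coef1; case: eqP => _; rewrite ?cj1 ?cj0.
rewrite map_rcons -!cats1 !big_cat !big_seq1 /= !mulrBr !coefB !coefMX !coefMC cjB cjM // ih.
by case: ifP => _; rewrite ?cj0 // ih.
Qed.

Lemma coef_prodXsub K s k : is_division_subring K -> (forall a, a \in s -> K a) ->
  K (prodXsub s)`_k.
Proof.
move=> hK; rewrite /prodXsub; elim/last_ind: s k => [|s a ih] k hs.
  by rewrite big_nil coef1; apply: dsr_nat.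
have hs' b : b \in s -> K b by move=> bs; apply: hs; rewrite mem_rcons inE bs orbT.
have Ka : K a by apply: hs; rewrite mem_rcons mem_head.
rewrite -cats1 big_cat big_seq1 /= mulrBr coefB coefMX coefMC; apply: (dsrB hK).
  by case: ifP => _; [apply: dsr0|apply: ih].
by apply: (dsrM hK) => //; apply: ih.
Qed.

(** The order of the factors matters over [D]; conjugation rotates an orbit, and the product has to
    survive this. *)
Lemma prodXsub_rot a s : (forall b, b \in s -> GRing.comm a b) ->
  prodXsub (a :: s) = prodXsub (rcons s a).
Proof.
move=> h; rewrite /prodXsub -cats1 big_cons big_cat big_seq1 /=.
elim: s h => [|b s ih] h; first by rewrite !big_nil mulr1 mul1r.
rewrite !big_cons -mulrA -ih; last by move=> c cs; apply: h; rewrite inE cs orbT.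
rewrite !mulrA; congr (_ * _).
have ab := h b (mem_head _ _).
rewrite !mulrBl !mulrBr -!polyCM ab -(commr_polyX b%:P) -(commr_polyX a%:P).
by rewrite !opprB addrACA [RHS]addrACA; congr (_ + _); rewrite addrC.
Qed.

(* The elementary symmetric functions of a finite cyclic orbit are fixed, hence central. *)
Lemma algebraic_of_finite_order L y n a : is_division_subring L -> abelian_set L ->
  (forall x, L x -> L (cj y x)) -> (forall x, L x -> GRing.comm x y -> center x) ->
  y != 0 -> (0 < n)%N -> cent L (y ^+ n) -> L a -> algebraic_over_center a.
Proof.
move=> hL abL iL fixL y0 n0 hyn La.
have Lit i : L (iter i (cj y) a) by elim: i => // i ih; apply: iL.
(* Starting at [i.+1] puts [a], which is its own [n]-th iterate, last, so that ['X - a%:P] is the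
   right factor wanted by the factor theorem. *)
pose s := mkseq (fun i => iter i.+1 (cj y) a) n.
have Ls b : b \in s -> L b by move=> /mapP [i _ ->].
have an : iter n (cj y) a = a.
  by rewrite -cj_expg // cj_comm ?expf_neq0_div //; apply/commr_sym/hyn.
have [k ek] : exists k, n = k.+1 by exists n.-1; rewrite prednK.
have es : prodXsub (map (cj y) s) = prodXsub s.
  have -> : map (cj y) s = rcons (mkseq (fun i => iter i.+2 (cj y) a) k) (cj y a).
    transitivity (mkseq (fun i => iter i.+2 (cj y) a) n); first by rewrite /s /mkseq -map_comp.
    by rewrite ek mkseqS iterS -ek an.
  have -> : s = cj y a :: mkseq (fun i => iter i.+2 (cj y) a) k.
    by rewrite /s ek /mkseq /= -[1%N]addn0 iotaDl -map_comp.
  rewrite prodXsub_rot // => b /mapP [i _ ->].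
  by apply: abL; [apply: iL|apply: (Lit i.+2)].
exists (prodXsub s); split.
- by rewrite /prodXsub monic_neq0 // monic_prod_XsubC.
- move=> i; apply: fixL; first exact: coef_prodXsub.
  by apply: (cj_fix hD y0); rewrite coef_prodXsub_cj // es.
apply/eqP/factor_theorem; exists (prodXsub (mkseq (fun i => iter i.+1 (cj y) a) k)).
by rewrite /s ek mkseqS -ek an /prodXsub -cats1 big_cat big_seq1.
Qed.

Lemma center_algebraic x : center x -> algebraic_over_center x.
Proof.
move=> hx; have hZ := center_divsubring D.
exists ('X - x%:P); split; first by rewrite polyXsubC_eq0.
  move=> i; rewrite coefB coefX coefC; apply: (dsrB hZ); first exact: dsr_nat.
  by case: ifP => _ //; apply: dsr0.
by rewrite hornerXsubC subrr.
Qed.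

Section Maximal.
Context (M : D -> Prop) (hnc : exists x y : D, x * y != y * x)
  (hM : maximal_subgroup M) (hirr : irreducible_subgroup M).
Let sM : is_subgroup M. Proof. by case: hM. Qed.

Lemma algebraic_derived_of_metabelian x0 : metabelian M ->
  M x0 -> ~ center x0 -> algebraic_over_center x0 -> algebraic_set (derived M).
Proof.
move=> hmet Mx0 nx0 algx0 a da.
have dM := derived_sub sM.
have [dc|ndc] := classic (forall x, derived M x -> center x).
  exact/center_algebraic/dc.
have hua E : is_division_subring E -> (forall x, star E x -> M x) -> abelian_set E.
  move=> hE EM; apply: (hua_metabelian hD hE) => x y dx dy.
  by apply: hmet; apply: derived_mono EM _; [exact: dx|exact: dy].
pose L := cent (derived M).
have dL x : derived M x -> L x by move=> dx y dy; apply: hmet.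
have hL : is_division_subring L := cent_divsubring _.
have idM : inv_under M (derived M) by apply: derived_inv => // g x; apply: sg_cj.
have iL : inv_under M L by move=> m z Mm; apply: (cent_inv hD sM idM).
have LM : forall x, star L x -> M x.
  have [//|Lc|Lall] := normalised_divsubring hD hM hL iL; case: ndc => x dx.
    exact/Lc/dL.
  by move=> y; apply/commr_sym/Lall.
have abL : abelian_set L by apply: hua.
have cL x : cent L x -> L x by move=> hx y /dL; apply: hx.
have centL x : center x -> L x by move=> hx y _; apply: hx.
suff [y [n [My nLy n0 hn]]] : exists y n, [/\ M y, ~ L y, (0 < n)%N & cent L (y ^+ n)].
  have y0 := sg_neq0 sM My.
  (* The fixed field of [y]. [M] normalises it because conjugates of [y] differ from [y] by
     commutators, which [L] centralises. *)
  pose L0 z := L z /\ GRing.comm z y.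
  have iL0 : inv_under M L0.
    move=> m z Mm [Lz zy]; have m0 := sg_neq0 sM Mm; split; first exact: iL.
    have zy' : GRing.comm z (cj m^-1 y).
      rewrite (cj_commutator hD) //; apply: commrM => //; apply: Lz.
      by apply: derived_comm => //; apply: (sgV sM).
    by have := cj_commute hD m0 zy'; rewrite cjVK.
  have hB := cent_divsubring L0.
  have iB : inv_under M (cent L0) by move=> m z Mm; apply: (cent_inv hD sM iL0).
  have By : cent L0 y by move=> z [_ /commr_sym].
  have LB x : L x -> cent L0 x by move=> Lx z [Lz _]; apply: abL.
  (* The centraliser of [L0] contains [L] and [y], which does not centralise [L]. Hence it is [D],
     and [L0] is central. *)
  have fixL x : L x -> GRing.comm x y -> center x.
    have [BM|Bc|Ball] := normalised_divsubring hD hM hB iB.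
    - case: nLy; apply: cL => z Lz; apply: (hua _ hB BM) => //; exact: LB.
    - by case: nLy; apply/centL/Bc.
    - by move=> Lx xy z; apply/commr_sym/Ball.
  apply: (algebraic_of_finite_order hL abL _ fixL y0 n0 hn); last exact: dL.
  by move=> x; apply: iL.
(* Outside [L], [x0] itself is the [y] sought: Dedekind's argument on its relation over the centre
   makes two of its powers act alike on [L]. Inside [L], its conjugates commute and any [y] outside
   [L] permutes them. *)
have [Lx0|nLx0] := classic (L x0); last first.
  exists x0; have x00 := sg_neq0 sM Mx0.
  have xi0 i : x0 ^+ i != 0 by apply: expf_neq0_div.
  have /algebraicP [n [c [hc c0 e]]] := algx0.
  pose chi b (i : 'I_n) := cj (x0 ^+ i)^-1 b.
  have Lchi b i : L b -> L (chi b i).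
    by move=> Lb; apply: iL => //; apply: (sgV sM); apply: sgX.
  have rel b (f : 'I_n -> D) : L b -> (forall i, L (f i)) -> \sum_i f i * x0 ^+ i = 0 ->
      \sum_i f i * chi b i * x0 ^+ i = 0.
    move=> Lb Lf ef; transitivity ((\sum_i f i * x0 ^+ i) * b); last by rewrite ef mul0r.
    rewrite mulr_suml; apply: eq_bigr => i _.
    by rewrite /chi /cj invrK -!mulrA mulVr ?hD // mulr1.
  have [i [j [ij _ _ hij]]] := dedekind hD (dsrB hL) (dsrM hL) abL Lchi
    (fun i => xi0 i) rel (fun i => centL _ (hc i)) c0 e.
  wlog ltij : i j ij hij / (i < j)%N.
    move=> H; have [] := ltngtP i j; first exact: H.
      by apply: H; rewrite 1?eq_sym // => b /hij.
    by move/val_inj => e'; rewrite e' eqxx in ij.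
  exists (j - i)%N; split=> //; first by rewrite subn_gt0.
  move=> b Lb; apply: commr_sym; apply: (cj_fix hD (xi0 _)).
  have := hij b Lb; rewrite /chi => /(congr1 (cj (x0 ^+ j))); rewrite cjVK //.
  rewrite -{1}(subnKC (ltnW ltij)) exprD cjMg // cjVK // => ->; by [].
have [y [My nLy]] : exists y, M y /\ ~ L y.
  apply: NNPP => H; apply: (M_not_central hnc hirr) => x Mx.
  apply: (cent_center hirr) => z Mz.
  by apply: abL; apply: NNPP => h; apply: H; [exists x|exists z].
pose O z := exists2 m, M m & z = cj m x0.
have iO : inv_under M O.
  move=> g _ Mg [m Mm ->]; exists (m * g); first exact: sgM.
  by rewrite cjMg ?(sg_neq0 sM).
have OL z : O z -> L z by move=> [m Mm ->]; apply: iL.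
have Ox0 : O x0 by exists 1; [apply: sg1|rewrite cj1g].
have hE := cent_divsubring O.
have iE : inv_under M (cent O) by move=> m z Mm; apply: (cent_inv hD sM iO).
have LE z : L z -> cent O z by move=> Lz w /OL; apply: abL.
have EM : forall x, star (cent O) x -> M x.
  have [//|Ec|Eall] := normalised_divsubring hD hM hE iE; case: nx0.
    exact/Ec/LE.
  by move=> z; apply/commr_sym/Eall.
have abE := hua _ hE EM.
have y0 := sg_neq0 sM My.
have [n hn] := conj_repeat hD algx0.
(* The exponent [j - i] at which [y] fixes a conjugate of [x0] varies with the conjugate, but always
   divides the factorial of [n]. That power lies in the commutative [cent O], which contains [L]. *)
exists y, n`!; split=> //; first exact: fact_gt0.
suff Ey : cent O (y ^+ n`!) by move=> z /LE; apply: abE.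
move=> z Oz; have yi0 i : y ^+ i != 0 by apply: expf_neq0_div.
have Oi i : O (cj (y ^+ i) z) by apply: iO => //; apply: sgX.
have hy i : exists2 g, g != 0 & cj (y ^+ i) z = cj g x0.
  by have [m Mm e] := Oi i; exists m => //; apply: (sg_neq0 sM).
have [|i [j [ij jn e]]] := hn (fun i => cj (y ^+ i) z) hy.
  by move=> i j; apply: abL; apply: OL.
have zy : GRing.comm z (y ^+ (j - i)).
  apply: (cj_fix hD (yi0 _)); apply: (cj_inj hD (yi0 i)).
  by rewrite -cjMg // -exprD subnK // ltnW.
have /dvdnP [k ->] : (j - i %| n`!)%N.
  by apply: dvdn_fact; rewrite subn_gt0 ij /= ltnW // (leq_ltn_trans (leq_subr _ _)).
by rewrite mulnC exprM; apply/commr_sym/commrX.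
Qed.

End Maximal.

End Backward.

Theorem theorem2p8 (D : unitRingType) (hD : is_division_ring D)
  (hnc : exists x y : D, x * y != y * x)
  (M : D -> Prop) (hM : maximal_subgroup M) (hirr : irreducible_subgroup M)
  (hls : locally_solvable M) :
  algebraic_set (derived M) <->
  (metabelian M /\ exists x, [/\ M x, ~ center x & algebraic_over_center x]).
Proof.
split=> [alg|[hmet [x [Mx nx algx]]]]; last first.
  exact: (algebraic_derived_of_metabelian hD hnc hM hirr hmet Mx nx algx).
split; first exact: (metabelian_of_algebraic_derived hD hnc hM hirr hls alg).
have sM : is_subgroup M by case: hM.
apply: NNPP => H; apply: (derived_not_central hD hnc hM hirr) => x dx.
apply: NNPP => nx; apply: H; exists x; split=> //; first exact: (derived_sub sM).
exact: alg.
Qed.
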